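(* Let $0<q<1$, $\alpha\ge0$, $\rho=e^{2\pi i/3}$, and let $a,b,x\in\mathbb{C}$ with $a\neq 0$, $x\ne0$, $|b|<|a|$, and, if $\alpha=0$, also $|b/a|<|x|<1$. Assume that no denominator below vanishes. Then $$\frac{(-b,-q/a,q,b/a;q)_\infty}{(-q,-b/a,b,q/a;q)_\infty}\,B_{q^2}^{(2\alpha)}(a^2,b^2;x^2)=\sum_{j=-\infty}^\infty\frac{(a;q)_j\,q^{\alpha j^2}(-x)^j}{(b;q)_j}\,B_q^{(\alpha)}(a,b;xq^{2\alpha j})$$ and $$B_{q^3}^{(3\alpha)}(a^3,b^3;x^3)=\frac{(b,q/a;q)_\infty^3}{(q,b/a;q)_\infty^3}\,\frac{(q^3,b^3a^{-3};q^3)_\infty}{(b^3,q^3a^{-3};q^3)_\infty}\sum_{j,k=-\infty}^\infty\frac{(a;q)_j(a;q)_k\,\rho^k q^{\alpha(j+k)^2}x^{j+k}}{(b;q)_j(b;q)_k}\,B_q^{(\alpha)}\bigl(a,b;\rho^2xq^{2\alpha(j+k)}\bigr).$$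
   Context: Notation: $(c;q)_\infty=\prod_{j\ge0}(1-cq^j)$, $(c_1,\dots,c_r;q)_\infty=\prod_i(c_i;q)_\infty$, and $(c;q)_n=(c;q)_\infty/(cq^n;q)_\infty$ for all $n\in\mathbb{Z}$; i.e. $(c;q)_n=\prod_{j=0}^{n-1}(1-cq^j)$ for $n\ge0$ and $(c;q)_{-n}=1/\prod_{j=1}^n(1-cq^{-j})$ for $n>0$. For $\alpha\ge0$ define $$B_q^{(\alpha)}(a,b;x)=\sum_{n=-\infty}^\infty\frac{(a;q)_n}{(b;q)_n}q^{\alpha n^2}x^n,$$ and $B_{q^2}^{(2\alpha)}$, $B_{q^3}^{(3\alpha)}$ are obtained by replacing $q$ by $q^2$, $q^3$ (everywhere) and $\alpha$ by $2\alpha$, $3\alpha$. The assumption that no denominator vanishes means: $a\ne q^{k}$ for integers $k\ge1$ and $b\neq q^{-k}$ for integers $k\ge0$; moreover $a^2\ne q^{2k}$ $(k\ge1)$, $b^2\ne q^{-2k}$ $(k\ge0)$ for the first identity, and $a^3\ne q^{3k}$ $(k\ge1)$, $b^3\neq q^{-3k}$ $(k\ge0)$ for the second. *)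

(* Defs.v *)
From HB Require Import structures.
From mathcomp Require Import all_boot all_order all_algebra finmap.
From mathcomp Require Import all_classical all_reals all_analysis.
From mathcomp Require Import complex.
From mathcomp.analysis.showcase Require Import summability.

Set Implicit Arguments.
Unset Strict Implicit.
Unset Printing Implicit Defensive.

Import Order.TTheory GRing.Theory Num.Theory.
Import numFieldNormedType.Exports.

Local Open Scope classical_set_scope.
Local Open Scope ring_scope.
Local Open Scope complex_scope.

(* The usual topology of the complex numbers, induced by the modulus. *)
HB.instance Definition _ (R : realType) := GRing.ComAlgebra.copy R[i] R[i]^o.
HB.instance Definition _ (R : realType) := Vector.copy R[i] R[i]^o.
HB.instance Definition _ (R : realType) := NormedModule.copy R[i] R[i]^o.

(* Series over Z and Z^2 are unordered sums: limits in R[i] of the finite      *)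
(* partial sums along the inclusion of finite index sets. In R[i] this is the  *)
(* same as absolute convergence. Where the series does not converge,           *)
(* [series_sum] is a junk value, so convergence is always asserted separately. *)
Definition series_cvg (R : realType) (I : choiceType) (f : I -> R[i]) : Prop :=
  cvg (partial_sum f @ totally).

Definition series_sum (R : realType) (I : choiceType) (f : I -> R[i]) : R[i] :=
  summability.sum f.

(* The partial products converge for every c as soon as 0 < q < 1. *)
Definition qpoch_inf (R : realType) (c : R[i]) (q : R) : R[i] :=
  lim ((fun n : nat => \prod_(0 <= j < n) (1 - c * (q ^+ j)%:C)) @ \oo).

Definition qpochs_inf (R : realType) (cs : seq R[i]) (q : R) : R[i] :=
  \prod_(c <- cs) qpoch_inf c q.

(* [Negz n] is -(n+1), so the factors of the second product are               *)
(* 1 - c q^-1, ..., 1 - c q^-(n+1).                                            *)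
(* Pitfall: for b = q^k with k >= 1, (b;q)_m has a vanishing denominator when  *)
(* m <= -k, so its reciprocal is 0. The convention 0^-1 = 0 yields (b;q)_m = 0 *)
(* here, hence again 1 / (b;q)_m = 0, the intended value.                      *)
Definition qpoch (R : realType) (c : R[i]) (q : R) (m : int) : R[i] :=
  match m with
  | Posz n => \prod_(0 <= j < n) (1 - c * (q ^+ j)%:C)
  | Negz n => (\prod_(1 <= j < n.+2) (1 - c * (q ^- j)%:C))^-1
  end.

Definition B_term (R : realType) (q alpha : R) (a b x : R[i]) (n : int) : R[i] :=
  qpoch a q n / qpoch b q n * (q `^ (alpha * (n ^+ 2)%:~R))%:C * x ^ n.

Definition B (R : realType) (q alpha : R) (a b x : R[i]) : R[i] :=
  series_sum (B_term q alpha a b x).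

(* exp (2 pi i / 3) *)
Definition rho (R : realType) : R[i] :=
  cos (2 * pi / 3) +i* sin (2 * pi / 3).
Arguments rho {R}.

(* Main.v *)
Require Import Defs.
From HB Require Import structures.
From mathcomp Require Import all_boot all_order all_algebra finmap.
From mathcomp Require Import all_classical all_reals all_analysis.
From mathcomp Require Import cyclic separable cyclotomic complex.
From mathcomp Require Import ring lra zify.
From mathcomp.analysis.showcase Require Import summability.

Set Implicit Arguments.
Unset Strict Implicit.
Unset Printing Implicit Defensive.

Import Order.TTheory GRing.Theory Num.Theory.
Import numFieldNormedType.Exports.
Import Normc.

Local Open Scope ring_scope.
Local Open Scope complex_scope.

(** Why the identities hold. Write A_n = (a; q)_n / (b; q)_n, choose a radius r
with |b / a| < r < 1, equal to |x| when alpha = 0, and put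
E(N) = q ^ (alpha N ^ 2) (x / r) ^ N. Because j^2 + 2 j n + n^2 = (j + n)^2, the
general term of the double series in the first identity is
(-1)^j (A_j r^j) (A_n r^n) E(j + n). So alpha and x enter only through a bounded
weight of the total index, and the remaining factors A_n r^n are absolutely
summable. The triple series of the second identity has the same form, with
weight E(j + k + n) and twists rho^k and rho^(2 n).

An identity between two absolutely convergent series carrying a weight of this
kind holds for every bounded weight as soon as it holds for the weights
N |-> z^N with z a root of unity ([series_sum_twist]): these span the periodic
weights, and periodic weights approximate bounded ones pointwise. For the weight
z^N a multiple series factors into values of f(y) = \sum_n A_n y^n on the circle
|y| = r. What remains is f(y) f(- y) = C f_2(y^2), respectively
f(y) f(rho y) f(rho^2 y) = C f_3(y^3), where f_p is the series f for the
parameters a^p, b^p and the base q^p ([psi_roots]). Both follow from Ramanujan's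
1psi1 summation ([ramanujan]), since the product of (w c; q)_inf over the p-th
roots of unity w is (c^p; q^p)_inf. The passage from the circle to the weight E,
and Fubini's theorem for the iterated sums, are in [weighted_identity].

Ramanujan's formula is obtained in the manner of Andrews and Askey. A relation
between f for (a, b) and f for (a, b q), iterated down to b = 0, shows that f is
an explicit function of b times a factor that depends on a and x only
([psi_den_factor]). That factor is read off at b = q^k with q^k < |a x|, where a
shift of the summation index leads to b = q, that is, to the q-binomial theorem
([q_binomial], [ramanujan_qX]). *)

(** * The modulus of a complex number as a real number *)

Section Modulus.
Variable R : realType.
Implicit Types z w : R[i].

Lemma normE z : `|z| = (normc z)%:C.
Proof. by []. Qed.

Lemma normc_ge0 z : 0 <= normc z.
Proof. by rewrite -ler0c -normE. Qed.

Lemma normcD z w : normc (z + w) <= normc z + normc w.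
Proof. by rewrite -lecR rmorphD /= -!normE ler_normD. Qed.

Lemma normcNr z : normc (- z) = normc z.
Proof. by apply: complexI; rewrite -!normE normrN. Qed.

Lemma normcB z w : normc (z - w) <= normc z + normc w.
Proof. by rewrite -(normcNr w) normcD. Qed.

Lemma normc_distC z w : normc (z - w) = normc (w - z).
Proof. by rewrite -normcNr opprB. Qed.

Lemma normc_eq0 z : (normc z == 0) = (z == 0).
Proof.
by apply/idP/idP => [/eqP/eq0_normc -> //|/eqP ->]; rewrite normc0.
Qed.

Lemma normc_gt0 z : (0 < normc z) = (z != 0).
Proof. by rewrite lt_def normc_ge0 andbT normc_eq0. Qed.

Lemma normc_real (t : R) : normc t%:C = `|t|.
Proof. by rewrite /= expr0n /= addr0 sqrtr_sqr. Qed.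

Lemma normc_nneg (t : R) : 0 <= t -> normc t%:C = t.
Proof. by move=> t0; rewrite normc_real ger0_norm. Qed.

Lemma normcX z n : normc (z ^+ n) = normc z ^+ n.
Proof. by elim: n => [|n IH]; rewrite ?expr0 ?normc1 // !exprS normcM IH. Qed.

Lemma normcXz z (n : int) : normc (z ^ n) = normc z ^ n.
Proof.
by case: n => n; rewrite -?exprnP ?NegzE -?exprnN ?normcV normcX.
Qed.

Lemma normc_sum (I : Type) (r : seq I) (f : I -> R[i]) :
  normc (\sum_(i <- r) f i) <= \sum_(i <- r) normc (f i).
Proof.
elim: r => [|i r IH]; first by rewrite !big_nil normc0.
by rewrite !big_cons (le_trans (normcD _ _)) ?lerD2l.
Qed.

Lemma normc_prod (I : Type) (r : seq I) (f : I -> R[i]) :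
  normc (\prod_(i <- r) f i) = \prod_(i <- r) normc (f i).
Proof.
elim: r => [|i r IH]; first by rewrite !big_nil normc1.
by rewrite !big_cons normcM IH.
Qed.

Lemma normc_Re z : `|complex.Re z| <= normc z.
Proof. by rewrite -lecR -normE normc_ge_Re. Qed.

Lemma normc_Im z : `|complex.Im z| <= normc z.
Proof.
case: z => x y /=; rewrite -sqrtr_sqr ler_wsqrtr //.
by rewrite lerDr sqr_ge0.
Qed.

(** The order on complex numbers is partial; real bounds on the modulus are what
linear arithmetic can use. *)
Lemma cvgcP (T : Type) (F : set_system T) {FF : Filter F} (u : T -> R[i]) l :
  ((u @ F --> l) <->
   (forall e : R, 0 < e -> \forall t \near F, normc (u t - l) < e))%classic.
Proof.
split=> [ul e e0|H].
  have /cvgrPdist_lt/(_ e%:C) := ul.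
  rewrite ltcR => /(_ e0); apply: filterS => t.
  by rewrite distrC normE ltcR.
apply/cvgrPdist_lt => e e0.
have [t Et] : exists t, e = t%:C by apply/complex_realP; exact: gtr0_real.
move: e0; rewrite {}Et ltcR => /H; apply: filterS => s.
by rewrite distrC normE ltcR.
Qed.

Lemma cvgc_normc (u : nat -> R[i]) l :
  (u @ \oo --> l -> normc (u n) @[n --> \oo] --> normc l)%classic.
Proof.
move=> /cvgcP H; apply/cvgrPdist_lt => e /H; apply: filterS => n.
apply: le_lt_trans; rewrite ler_norml; apply/andP; split.
  rewrite lerBrDl -lerBrDr opprK; apply: le_trans (normcD _ _).
  by rewrite addrC subrK.
rewrite lerBlDr normc_distC; apply: le_trans (normcD _ _).
by rewrite subrK.
Qed.

End Modulus.

(** * Unordered sums of complex families *)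

#[local] Existing Instance totally_filter.

Section Sums.
Variable R : realType.
Implicit Types (I J : choiceType).

(** Carrying the value of a sum in a relation, rather than in [series_sum],
makes linearity and uniqueness usable before convergence is known. *)
Definition has_sum I (f : I -> R[i]) (s : R[i]) : Prop :=
  (partial_sum f @ totally --> s)%classic.

Definition abs_summable I (f : I -> R[i]) : Prop :=
  exists M : R, forall K : {fset I}, \sum_(i <- K) normc (f i) <= M.

Lemma partial_sumE I (f : I -> R[i]) (K : {fset I}) :
  partial_sum f K = \sum_(i <- K) f i.
Proof. by rewrite /partial_sum big_seq_fsetE. Qed.

Lemma fset_sumU (V : nmodType) I (f : I -> V) (K L : {fset I}) :
  [disjoint K & L]%fset ->
  \sum_(i <- (K `|` L)%fset) f i = \sum_(i <- K) f i + \sum_(i <- L) f i.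
Proof.
move=> /fdisjointP KL; rewrite -big_cat; apply: perm_big; apply: uniq_perm => //.
  rewrite cat_uniq !fset_uniq andbT /=; apply/hasPn => i iL.
  by apply/negP => /KL; rewrite iL.
by move=> i; rewrite in_fsetU mem_cat.
Qed.

Lemma fset_sumM (V : nmodType) I J (f : I * J -> V) (K : {fset I}) (L : {fset J}) :
  \sum_(p <- (K `*` L)%fset) f p = \sum_(i <- K) \sum_(j <- L) f (i, j).
Proof.
rewrite -big_allpairs; apply: perm_big; apply: uniq_perm => //.
  by apply: allpairs_uniq; rewrite ?fset_uniq // => -[? ?] [? ?] _ _ [-> ->].
move=> [i j]; rewrite in_fsetM; apply/idP/allpairsP => /=.
  by move=> /andP[iK jL]; exists (i, j).
by move=> [[i' j'] /= [iK jL [-> ->]]]; rewrite iK.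
Qed.

Lemma fset_sum_sub I (f : I -> R) (K L : {fset I}) :
  (K `<=` L)%fset -> (forall i, 0 <= f i) ->
  \sum_(i <- K) f i <= \sum_(i <- L) f i.
Proof.
move=> KL f0; have -> : L = (K `|` (L `\` K))%fset.
  by apply/fsetP => i; rewrite !inE orb_andr orbN /= orb_idl // => /(fsubsetP KL).
rewrite fset_sumU; last first.
  by apply/fdisjointP => i iK; rewrite in_fsetD iK.
by rewrite lerDl sumr_ge0.
Qed.

Lemma fset_sum_le_seq I (f : I -> R) (K : {fset I}) (s : seq I) :
  uniq s -> {subset K <= s} -> (forall i, 0 <= f i) ->
  \sum_(i <- K) f i <= \sum_(i <- s) f i.
Proof.
move=> us Ks f0; have KL : (K `<=` [fset i in s])%fset.
  by apply/fsubsetP => i /Ks; rewrite in_fset.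
apply: le_trans (fset_sum_sub KL f0) _; rewrite (perm_big s) //.
by apply: uniq_perm => // i; rewrite in_fset.
Qed.

Lemma has_sumP I (f : I -> R[i]) s :
  has_sum f s <->
  (forall e : R, 0 < e -> exists J : {fset I}, forall K : {fset I},
     (J `<=` K)%fset -> normc (\sum_(i <- K) f i - s) < e).
Proof.
split=> [/cvgcP H e /H [J _ HJ]|H].
  by exists J => K JK; rewrite -partial_sumE; apply: HJ.
apply/cvgcP => e /H [J HJ]; exists J => // K JK.
by rewrite partial_sumE; apply: HJ.
Qed.

Lemma has_sum_unique I (f : I -> R[i]) s t :
  has_sum f s -> has_sum f t -> s = t.
Proof. exact: cvg_unique. Qed.

Lemma has_sum_cvg I (f : I -> R[i]) s : has_sum f s -> series_cvg f.
Proof. by move=> fs; apply/cvg_ex; exists s. Qed.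

Lemma has_sumE I (f : I -> R[i]) s : has_sum f s -> series_sum f = s.
Proof. by move=> fs; apply/cvg_lim. Qed.

Lemma has_sum_ext I (f g : I -> R[i]) s : f =1 g -> has_sum f s -> has_sum g s.
Proof. by move=> /funext ->. Qed.

Lemma has_sumD I (f g : I -> R[i]) s t :
  has_sum f s -> has_sum g t -> has_sum (fun i => f i + g i) (s + t).
Proof.
move=> fs gt; have -> : (fun i => f i + g i) = f \+ g by [].
rewrite /has_sum; have -> : partial_sum (f \+ g) = partial_sum f \+ partial_sum g.
  by apply/funext => K; rewrite /= !partial_sumE big_split.
exact: (cvgD fs gt).
Qed.

Lemma has_sumZ I (f : I -> R[i]) s c :
  has_sum f s -> has_sum (fun i => c * f i) (c * s).
Proof.
move=> fs; rewrite /has_sum.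
have -> : partial_sum (fun i => c * f i) = (fun=> c) \* partial_sum f.
  by apply/funext => K; rewrite /= !partial_sumE mulr_sumr.
exact: (cvgM (cvg_cst c) fs).
Qed.
Arguments has_sumZ {I f s} c.

Lemma has_sumB I (f g : I -> R[i]) s t :
  has_sum f s -> has_sum g t -> has_sum (fun i => f i - g i) (s - t).
Proof.
move=> fs /(has_sumZ (-1)) gt; rewrite -mulN1r.
by apply: has_sum_ext (has_sumD fs gt) => i /=; rewrite mulN1r.
Qed.

Lemma has_sum_big I (T : Type) (r : seq T) (F : T -> I -> R[i]) (S : T -> R[i]) :
  (forall t, has_sum (F t) (S t)) ->
  has_sum (fun i => \sum_(t <- r) F t i) (\sum_(t <- r) S t).
Proof.
move=> FS; elim: r => [|t r IH].
  rewrite big_nil; apply/has_sumP => e e0; exists fset0 => K _.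
  by rewrite big1 ?subrr ?normc0 // => i _; rewrite big_nil.
rewrite big_cons; apply: has_sum_ext (has_sumD (FS t) IH) => i.
by rewrite big_cons.
Qed.

Arguments has_sum_big {I T} r {F S}.

Lemma has_sum_reindex I J (h : J -> I) (g : I -> J) (f : I -> R[i]) s :
  cancel h g -> cancel g h -> has_sum f s -> has_sum (f \o h) s.
Proof.
move=> hK gK /has_sumP fs; apply/has_sumP => e /fs [L HL].
exists [fset g i | i in L]%fset => K LK.
have -> : \sum_(i <- K) (f \o h) i = \sum_(i <- [fset h j | j in K]%fset) f i.
  by rewrite big_imfset //= => x y _ _ /(can_inj hK).
apply: HL; apply/fsubsetP => i iL; apply/imfsetP; exists (g i); last by rewrite gK.
by apply: (fsubsetP LK); apply/imfsetP; exists i.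
Qed.

(** Boundedness of the partial sums of a non-negative family makes its supremum
the sum; the general case splits a complex family into four of these. *)
Lemma has_sum_nneg I (g : I -> R) (M : R) :
  (forall i, 0 <= g i) -> (forall K : {fset I}, \sum_(i <- K) g i <= M) ->
  exists s : R, has_sum (fun i => (g i)%:C) s%:C.
Proof.
move=> g0 gM; pose A := [set \sum_(i <- K) g i | K in [set: {fset I}]]%classic.
have supA : has_sup A.
  split; first by exists (\sum_(i <- fset0) g i), fset0.
  by exists M => _ [K _ <-].
exists (sup A); apply/has_sumP => e e0.
have [_ [J _ <-] HJ] := sup_adherent e0 supA.
exists J => K JK; have -> : \sum_(i <- K) (g i)%:C - (sup A)%:C = (\sum_(i <- K) g i - sup A)%:C.
  by rewrite rmorphB rmorph_sum.
rewrite normc_real.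
have leK : \sum_(i <- K) g i <= sup A by apply: sup_upper_bound => //; exists K.
have := fset_sum_sub JK g0.
rewrite ler0_norm; last by rewrite subr_le0.
by move=> h; rewrite opprB ltrBlDr -ltrBlDl (lt_le_trans HJ).
Qed.

Lemma has_sum_real I (g : I -> R) (M : R) :
  (forall K : {fset I}, \sum_(i <- K) `|g i| <= M) ->
  exists s : R, has_sum (fun i => (g i)%:C) s%:C.
Proof.
move=> gM.
have [s1 h1] : exists s : R, has_sum (fun i => (g i + `|g i|)%:C) s%:C.
  apply: (@has_sum_nneg _ _ (M + M)) => [i|K].
    by rewrite addrC -lerBlDr sub0r -normrN ler_norm.
  rewrite big_split lerD // (le_trans _ (gM K)) // ler_sum // => i _.
  exact: ler_norm.
have [s2 h2] := @has_sum_nneg _ (fun i => `|g i|) M (fun i => normr_ge0 _) gM.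
exists (s1 - s2); rewrite rmorphB; apply: has_sum_ext (has_sumB h1 h2) => i /=.
by rewrite -rmorphB /= addrK.
Qed.

(** Real and imaginary parts are real families that are absolutely summable,
because they are dominated by the modulus. *)
Lemma abs_summable_has_sum I (f : I -> R[i]) :
  abs_summable f -> has_sum f (series_sum f).
Proof.
case=> M fM.
have [s hs] : exists s : R, has_sum (fun i => (complex.Re (f i))%:C) s%:C.
  apply: (@has_sum_real _ _ M) => K; rewrite (le_trans _ (fM K)) // ler_sum // => i _.
  exact: normc_Re.
have [t ht] : exists s : R, has_sum (fun i => (complex.Im (f i))%:C) s%:C.
  apply: (@has_sum_real _ _ M) => K; rewrite (le_trans _ (fM K)) // ler_sum // => i _.
  exact: normc_Im.
have h : has_sum f (s%:C + 'i%C * t%:C).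
  by apply: has_sum_ext (has_sumD hs (has_sumZ 'i%C ht)) => i; rewrite -complexE.
by rewrite (has_sumE h).
Qed.

Lemma has_sum_normc_le I (f : I -> R[i]) s (J : {fset I}) (B : R) :
  has_sum f s ->
  (forall K : {fset I}, (J `<=` K)%fset -> normc (\sum_(i <- K) f i) <= B) ->
  normc s <= B.
Proof.
move=> /has_sumP fs fB; apply/ler_addgt0Pr => e /fs [L HL].
have := HL (J `|` L)%fset (fsubsetUr _ _).
have := fB (J `|` L)%fset (fsubsetUl _ _).
set S := \sum_(i <- _) _ => hB /ltW hS.
rewrite -[s](subrK S) (le_trans (normcD _ _)) // addrC lerD //.
by rewrite normc_distC.
Qed.

Lemma abs_summable_le I (f g : I -> R[i]) (C : R) :
  abs_summable g -> (forall i, normc (f i) <= C * normc (g i)) ->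
  abs_summable f.
Proof.
move=> [M gM] fg; exists (`|C| * M) => K.
have /le_trans -> // : \sum_(i <- K) normc (f i) <= `|C| * \sum_(i <- K) normc (g i).
  rewrite mulr_sumr ler_sum // => i _; apply: le_trans (fg i) _.
  by rewrite ler_wpM2r ?normc_ge0 // ler_norm.
by rewrite ler_wpM2l.
Qed.

Lemma abs_summableZ I (f : I -> R[i]) c :
  abs_summable f -> abs_summable (fun i => c * f i).
Proof.
move=> /(@abs_summable_le I (fun i => c * f i) f (normc c)).
by apply => i; rewrite normcM.
Qed.

Lemma abs_summable_reindex I J (h : J -> I) (f : I -> R[i]) :
  injective h -> abs_summable f -> abs_summable (f \o h).
Proof.
move=> hI [M fM]; exists M => K; apply: le_trans (fM [fset h j | j in K]%fset).
by rewrite big_imfset //= => x y _ _ /hI.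
Qed.

Lemma abs_summable_tail I (f : I -> R[i]) (e : R) : 0 < e -> abs_summable f ->
  exists J : {fset I}, forall K : {fset I}, [disjoint J & K]%fset ->
    \sum_(i <- K) normc (f i) < e.
Proof.
move=> e0 [M fM]; pose A := [set \sum_(i <- K) normc (f i) | K in [set: {fset I}]]%classic.
have supA : has_sup A.
  split; first by exists (\sum_(i <- fset0) normc (f i)), fset0.
  by exists M => _ [K _ <-].
have [_ [J _ <-] HJ] := sup_adherent e0 supA.
exists J => K JK.
have : \sum_(i <- (J `|` K)%fset) normc (f i) <= sup A.
  by apply: sup_upper_bound => //; exists (J `|` K)%fset.
rewrite fset_sumU //=; move: HJ; rewrite ltrBlDr => HJ h.
by rewrite -(ltrD2l (\sum_(i <- J) normc (f i))) (le_lt_trans h).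
Qed.

(** Tannery's theorem: outside a finite set that carries almost all of the
dominating sum both series are small, and on that set convergence is termwise. *)
Lemma series_sum_dominated I (F : nat -> I -> R[i]) (f g : I -> R[i]) :
  abs_summable g -> (forall k i, normc (F k i) <= normc (g i)) ->
  (forall i, (F k i @[k --> \oo] --> f i)%classic) ->
  (series_sum (F k) @[k --> \oo] --> series_sum f)%classic.
Proof.
move=> ag Fg Ff.
have fg i : normc (f i) <= normc (g i).
  by apply: (cvgr_to_le (cvgc_normc (Ff i))); exact: nearW.
have aF k : abs_summable (F k).
  by apply: (abs_summable_le (C := 1) ag) => i; rewrite mul1r.
have af : abs_summable f.
  by apply: (abs_summable_le (C := 1) ag) => i; rewrite mul1r.
apply/cvgcP => e e0; have e4 : 0 < e / 4 by rewrite divr_gt0.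
have [J HJ] := abs_summable_tail e4 ag.
have : (\sum_(i <- J) normc (F k i - f i) @[k --> \oo] --> (0 : R))%classic.
  elim: (enum_fset J) => [|i r IH].
    by under eq_fun do rewrite big_nil; exact: cvg_cst.
  under eq_fun do rewrite big_cons.
  have h : (normc (F k i - f i) @[k --> \oo] --> (0 : R))%classic.
    rewrite -(normc0 R); apply: cvgc_normc.
    rewrite -(subrr (f i)); exact: (cvgB (Ff i) (cvg_cst (f i))).
  have h2 := cvgD h IH; rewrite addr0 in h2; exact: h2.
move=> /cvgrPdist_lt/(_ _ e4); apply: filterS => k.
rewrite sub0r normrN ger0_norm; last by rewrite sumr_ge0 // => i _; rewrite normc_ge0.
move=> hk.
suff : normc (series_sum (F k) - series_sum f) <= e / 4 + (e / 4 + e / 4).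
  by move=> /le_lt_trans; apply; lra.
have dis K : [disjoint J & (K `\` J)]%fset.
  by apply/fdisjointP => i iJ; rewrite in_fsetD iJ.
have hs := has_sumB (abs_summable_has_sum (aF k)) (abs_summable_has_sum af).
apply: (has_sum_normc_le (J := J) hs) => K JK.
apply: le_trans (normc_sum _ _) _.
have -> : K = (J `|` (K `\` J))%fset.
  by apply/fsetP => i; rewrite !inE orb_andr orbN /= orb_idl // => /(fsubsetP JK).
rewrite fset_sumU //.
rewrite lerD ?(ltW hk) //.
have hd := HJ (K `\` J)%fset (dis K).
apply: le_trans (_ : \sum_(i <- (K `\` J)%fset) (normc (g i) + normc (g i)) <= _).
  by apply: ler_sum => i _; rewrite (le_trans (normcB _ _)) // lerD.
by rewrite big_split lerD // ltW.
Qed.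

(** Fubini's theorem: the sums over finite rectangles converge both to the
iterated sum and to the double sum. *)
Lemma series_sum_fubini I J (F : I * J -> R[i]) : abs_summable F ->
  [/\ forall i, abs_summable (fun j => F (i, j)),
      abs_summable (fun i => series_sum (fun j => F (i, j))) &
      series_sum (fun i => series_sum (fun j => F (i, j))) = series_sum F].
Proof.
move=> aF; have [M FM] := aF.
have aFi i : abs_summable (fun j => F (i, j)).
  by have := @abs_summable_reindex _ _ (fun j => (i, j)) F _ aF; apply => ? ? [].
pose g i := series_sum (fun j => F (i, j)).
have hg i : has_sum (fun j => F (i, j)) (g i) by exact: abs_summable_has_sum.
(* Finitely many rows are approximated at once by a rectangle. *)
have approx (K : {fset I}) (e : R) : 0 < e -> exists L0 : {fset J}, forall L,
    (L0 `<=` L)%fset -> normc (\sum_(i <- K) \sum_(j <- L) F (i, j) - \sum_(i <- K) g i) < e.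
  move=> e0; have /has_sumP/(_ _ e0) := has_sum_big K (fun i => hg i).
  case=> L0 HL; exists L0 => L /HL; by rewrite exchange_big.
have hs : has_sum g (series_sum F).
  have /has_sumP H := abs_summable_has_sum aF.
  apply/has_sumP => e e0; have e2 : 0 < e / 2 by rewrite divr_gt0.
  have [P HP] := H _ e2; exists [fset p.1 | p in P]%fset => K PK.
  have [L0 HL] := approx K _ e2.
  have := HL ([fset p.2 | p in P] `|` L0)%fset (fsubsetUr _ _).
  rewrite -fset_sumM; set Q := (K `*` _)%fset => h1.
  have PQ : (P `<=` Q)%fset.
    apply/fsubsetP => p pP; rewrite !inE; apply/andP; split.
      by apply: (fsubsetP PK); apply/imfsetP; exists p.
    by apply/orP; left; apply/imfsetP; exists p.
  have h2 := HP _ PQ.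
  set s := \sum_(p <- Q) F p in h1 h2.
  rewrite -[X in normc (X - _)](subrK s) -addrA (le_lt_trans (normcD _ _)) //.
  by rewrite [ltRHS]splitr ltrD // normc_distC.
split => //; last exact: has_sumE.
(* The phases c_i turn the sum of the moduli of the row sums into the modulus
   of one sum over columns, whose partial sums are bounded by M. *)
exists M => K; pose c i := (normc (g i))%:C / g i.
have cg i : c i * g i = (normc (g i))%:C.
  have [g0|g0] := eqVneq (g i) 0; last by rewrite divfK.
  by rewrite g0 mulr0 normc0.
have c1 i : normc (c i) <= 1.
  rewrite normcM normcV normc_nneg ?normc_ge0 //.
  have [->|g0] := eqVneq (normc (g i)) 0; first by rewrite mul0r.
  by rewrite divff.
have <- : normc (\sum_(i <- K) c i * g i) = \sum_(i <- K) normc (g i).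
  rewrite (eq_bigr _ (fun i _ => cg i)) -rmorph_sum normc_nneg //.
  by rewrite sumr_ge0 // => i _; rewrite normc_ge0.
have h := has_sum_big K (fun i => has_sumZ (c i) (hg i)).
apply: (has_sum_normc_le (J := fset0) h) => L _; rewrite exchange_big /=.
apply: le_trans (FM (K `*` L)%fset); rewrite fset_sumM.
apply: le_trans (normc_sum _ _) _; apply: ler_sum => i _.
apply: le_trans (normc_sum _ _) _; apply: ler_sum => j _.
by rewrite normcM ler_piMl ?normc_ge0.
Qed.

End Sums.

Arguments has_sumZ {R I f s} c.
Arguments has_sum_big {R I T} r {F S}.

Section SumTheorems.
Variable R : realType.
Implicit Types (I J : choiceType).

(** Absolute summability of the product family is checked on rectangles; the
value is then Fubini's theorem. *)
Lemma series_sum_prod I J (u : I -> R[i]) (v : J -> R[i]) :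
  abs_summable u -> abs_summable v ->
  abs_summable (fun p : I * J => u p.1 * v p.2) /\
  series_sum (fun p : I * J => u p.1 * v p.2) = series_sum u * series_sum v.
Proof.
move=> au av; have [M uM] := au; have [N vN] := av.
have a : abs_summable (fun p : I * J => u p.1 * v p.2).
  exists (M * N) => K.
  pose K1 := [fset p.1 | p in K]%fset; pose K2 := [fset p.2 | p in K]%fset.
  have KK : (K `<=` K1 `*` K2)%fset.
    apply/fsubsetP => p pK; rewrite in_fsetM; apply/andP.
    by split; apply/imfsetP; exists p.
  apply: le_trans (fset_sum_sub KK (fun _ => normc_ge0 _)) _; rewrite fset_sumM.
  apply: le_trans (_ : \sum_(i <- K1) normc (u i) * N <= _).
    apply: ler_sum => i _; rewrite -(eq_bigr _ (fun j _ => esym (normcM _ _))) /=.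
    by rewrite -mulr_sumr ler_wpM2l ?normc_ge0.
  rewrite -mulr_suml ler_wpM2r // (le_trans _ (vN fset0)) //.
  by rewrite sumr_ge0 // => i _; exact: normc_ge0.
split=> //; have [_ _ <-] := series_sum_fubini a.
apply: has_sumE; rewrite mulrC.
apply: has_sum_ext (has_sumZ (series_sum v) (abs_summable_has_sum au)) => i /=.
by rewrite mulrC; apply/esym/has_sumE; exact: has_sumZ (abs_summable_has_sum av).
Qed.

Lemma geo_sum_le (t : R) (n : nat) : 0 <= t -> t < 1 ->
  \sum_(0 <= j < n) t ^+ j <= (1 - t)^-1.
Proof.
move=> t0 t1; rewrite -[leRHS]mul1r ler_pdivlMr ?subr_gt0 //.
suff -> : (\sum_(0 <= j < n) t ^+ j) * (1 - t) = 1 - t ^+ n.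
  by rewrite gerDl oppr_le0 exprn_ge0.
elim: n => [|n IH]; first by rewrite big_nil mul0r expr0 subrr.
by rewrite big_nat_recr //= mulrDl IH exprSr; ring.
Qed.

Lemma abs_summable_int (f : int -> R[i]) (B t : R) : 0 <= t < 1 ->
  (forall n : nat, normc (f n%:Z) <= B * t ^+ n) ->
  (forall n : nat, normc (f (- n%:Z)) <= B * t ^+ n) -> abs_summable f.
Proof.
move=> /andP[t0 t1] fp fm.
have B0 : 0 <= B by have := fp 0%N; rewrite expr0 mulr1; apply: le_trans (normc_ge0 _).
exists (B / (1 - t) + B / (1 - t)) => K.
have geo (N : nat) : \sum_(m <- iota 0 N) B * t ^+ m <= B / (1 - t).
  have -> : iota 0 N = index_iota 0 N by rewrite /index_iota subn0.
  by rewrite -mulr_sumr ler_wpM2l // geo_sum_le.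
pose N := (\max_(k <- K) `|k|%N).+1.
pose s := [seq Posz m | m <- iota 0 N] ++ [seq Negz m | m <- iota 0 N].
apply: le_trans (fset_sum_le_seq (s := s) _ _ (fun _ => normc_ge0 _)) _.
- rewrite cat_uniq !map_inj_uniq ?iota_uniq; last 2 first.
  + by move=> ? ? [].
  + by move=> ? ? [].
  by rewrite andTb andbT; apply/hasPn => _ /mapP[m _ ->]; apply/negP => /mapP[].
- move=> k kK; have kN : (`|k| < N)%N by rewrite ltnS leq_bigmax_seq.
  rewrite mem_cat; case: k kN {kK} => m mN; apply/orP; [left|right];
    apply/mapP; exists m; rewrite // mem_iota //=.
  by move: mN; rewrite NegzE abszN /=; exact: ltnW.
rewrite big_cat !big_map lerD // (le_trans _ (geo N)) // ler_sum // => m _.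
rewrite NegzE (le_trans (fm _)) // ler_wpM2l // exprS ler_piMl ?exprn_ge0 //.
exact: ltW.
Qed.

Lemma prim_root_exists (n : nat) : (0 < n)%N -> exists z : R[i], n.-primitive_root z.
Proof.
pose p : {poly R[i]} := 'X^n - 1; have [r Dp] := closed_field_poly_normal p.
move=> n_gt0; rewrite (monicP _) ?monicXnsubC // scale1r in Dp.
have rn1 : all n.-unity_root r by apply/allP=> z; rewrite -root_prod_XsubC -Dp.
have sz_r : (n < (size r).+1)%N.
  by rewrite -(size_prod_XsubC r id) -Dp size_XnsubC.
have [|z] := hasP (has_prim_root n_gt0 rn1 _ sz_r); last by exists z.
by rewrite -separable_prod_XsubC -Dp separable_Xn_sub_1 // pnatr_eq0 -lt0n.
Qed.

Lemma unity_root_neq0 (P : nat) (z : R[i]) : (0 < P)%N -> z ^+ P = 1 -> z != 0.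
Proof.
move=> P0 zP; apply: contra_eq_neq zP => ->.
by rewrite expr0n eqn0Ngt P0 eq_sym oner_neq0.
Qed.

(** The discrete Fourier transform: the coefficient of the character
[n |-> (z ^+ k) ^ n] is the inner sum. *)
Lemma periodic_expansion (P : nat) (z : R[i]) (F : nat -> R[i]) (n : int) :
  (0 < P)%N -> P.-primitive_root z ->
  F `|(n %% P)%Z|%N =
  \sum_(k < P) (\sum_(K < P) F K * z ^- (k * K) / P%:R) * (z ^+ k) ^ n.
Proof.
move=> P0 zP; have z0 := unity_root_neq0 P0 (prim_expr_order zP).
have zu : z \is a GRing.unit by rewrite unitfE.
have Pn0 : P%:Z != 0 by case: P P0 {zP}.
set r := `|(n %% P)%Z|%N.
have rE : (n %% P)%Z = r by rewrite /r gez0_abs // modz_ge0.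
have rP : (r < P)%N by have := ltz_pmod n (_ : 0 < P%:Z); rewrite rE ltz_nat; apply.
have zn k : (z ^+ k) ^ n = z ^+ (k * r).
  rewrite (divz_eq n P) rE expfzDr; last by rewrite expf_neq0.
  have -> : (z ^+ k) ^ ((n %/ P)%Z * P%:Z) = 1.
    rewrite mulrC -exprz_exp -exprnP -exprM mulnC exprM (prim_expr_order zP).
    by rewrite expr1n exp1rz.
  by rewrite mul1r -exprnP -exprM.
under eq_bigr => k _ do rewrite zn mulr_suml.
rewrite exchange_big /= (bigD1 (Ordinal rP)) //= [X in _ + X]big1 ?addr0; last first.
  move=> K /eqP Kr; have w1 : z ^+ r / z ^+ K != 1.
    apply/eqP => /(congr1 ( *%R^~ (z ^+ K))); rewrite mul1r divrK ?unitrX //.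
    move/eqP; rewrite (eq_prim_root_expr zP) !modn_small // => /eqP h.
    by apply: Kr; apply: val_inj.
  have : (\sum_(k < P) (z ^+ r / z ^+ K) ^+ k) * (z ^+ r / z ^+ K - 1) = 0.
    rewrite mulrC -subrX1 expr_div_n -!exprM mulnC exprM (prim_expr_order zP).
    by rewrite mulnC exprM (prim_expr_order zP) !expr1n invr1 mulr1 subrr.
  move/eqP; rewrite mulf_eq0 subr_eq0 (negPf w1) orbF => /eqP h.
  transitivity (F K / P%:R * \sum_(k < P) (z ^+ r / z ^+ K) ^+ k).
    rewrite mulr_sumr; apply: eq_bigr => k _.
    rewrite expr_div_n -!exprM (mulnC r) (mulnC K); ring.
  by rewrite h mulr0.
transitivity (\sum_(k < P) F r / P%:R).
  by rewrite sumr_const card_ord -(mulr_natr (F r / _)) divfK // pnatr_eq0 -lt0n.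
apply: eq_bigr => k _; have u : z ^- (k * r) * z ^+ (k * r) = 1.
  by rewrite mulVr ?unitrX.
by rewrite /= -[RHS]mulrA (mulrC P%:R^-1) mulrA -(mulrA (F r)) u mulr1.
Qed.

(** The bounded functions [e] for which the two series agree form a subspace,
closed under bounded pointwise limits, that contains the characters
[n |-> w ^ n]. These span the periodic functions, and every bounded function is
a limit of periodic ones that agree with it on longer and longer windows. *)
Lemma series_sum_twist I J (v : I -> R[i]) (f : I -> int)
    (w : J -> R[i]) (g : J -> int) :
  abs_summable v -> abs_summable w ->
  (forall (P : nat) (z : R[i]), (0 < P)%N -> z ^+ P = 1 ->
     series_sum (fun i => v i * z ^ f i) = series_sum (fun j => w j * z ^ g j)) ->
  forall (e : int -> R[i]) (B : R), (forall n, normc (e n) <= B) ->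
    series_sum (fun i => v i * e (f i)) = series_sum (fun j => w j * e (g j)).
Proof.
move=> av aw H e B eB.
have B0 : 0 <= B by apply: le_trans (normc_ge0 _) (eB 0).
have bnd T (u : T -> R[i]) (h : T -> int) (e' : int -> R[i]) t :
    (forall n, normc (e' n) <= B) ->
    normc (u t * e' (h t)) <= normc (B%:C * u t).
  by move=> e'B; rewrite mulrC !normcM ler_wpM2r ?normc_ge0 // normc_nneg.
(* eM M is the function of period 2 M + 1 that agrees with e on [-M, M]. *)
pose win (M : nat) (r : nat) := e (r%:Z - M%:Z).
pose eM (M : nat) (n : int) := win M `|((n + M%:Z)%R %% (2 * M).+1)%Z|%N.
have eMB M n : normc (eM M n) <= B by exact: eB.
have eM_small M n : (`|n| <= M)%N -> eM M n = e n.
  move=> nM; rewrite /eM /win modz_small; last by apply/andP; split; lia.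
  by congr e; lia.
have lim T (u : T -> R[i]) (h : T -> int) t :
    (u t * eM M (h t) @[M --> \oo] --> u t * e (h t))%classic.
  apply: cvg_near_cst; exists `|h t|%N => // M /= hM.
  by rewrite eM_small.
have L1 : (series_sum (fun i => v i * eM M (f i)) @[M --> \oo] -->
    series_sum (fun i => v i * e (f i)))%classic.
  apply: (series_sum_dominated (g := fun i => B%:C * v i)).
  - exact: abs_summableZ.
  - by move=> M i; exact: bnd.
  - by move=> i; exact: lim.
have L2 : (series_sum (fun j => w j * eM M (g j)) @[M --> \oo] -->
    series_sum (fun j => w j * e (g j)))%classic.
  apply: (series_sum_dominated (g := fun i => B%:C * w i)).
  - exact: abs_summableZ.
  - by move=> M i; exact: bnd.
  - by move=> i; exact: lim.
suff E M : series_sum (fun i => v i * eM M (f i)) = series_sum (fun j => w j * eM M (g j)).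
  by move: L1; rewrite (funext E) => L1; apply: cvg_unique L1 L2.
have P0 : (0 < (2 * M).+1)%N by [].
have [z zP] := prim_root_exists P0.
pose c k := \sum_(K < (2 * M).+1) win M K * z ^- (k * K) / (2 * M).+1%:R.
have zk k : (z ^+ k) ^+ (2 * M).+1 = 1.
  by rewrite -exprM mulnC exprM (prim_expr_order zP) expr1n.
have nzk k n : normc ((z ^+ k) ^ n) = 1.
  have /(congr1 (@normc R)) := zk k; rewrite normcX normc1 => /eqP.
  rewrite pexpr_eq1 ?normc_ge0 // => /eqP h; by rewrite normcXz h exp1rz.
have unr k (T : choiceType) (u : T -> R[i]) (h : T -> int) : abs_summable u ->
    abs_summable (fun i => u i * (z ^+ k) ^ h i).
  by move/(abs_summable_le (C := 1)); apply => i; rewrite normcM nzk mulr1 mul1r.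
have ex n : eM M n = \sum_(k < (2 * M).+1) (c k * (z ^+ k) ^ M) * (z ^+ k) ^ n.
  rewrite /eM (periodic_expansion _ _ P0 zP); apply: eq_bigr => k _.
  rewrite -mulrA; congr (_ * _); rewrite addrC expfzDr // expf_neq0 //.
  exact: unity_root_neq0 P0 (prim_expr_order zP).
have main (T : choiceType) (u : T -> R[i]) (h : T -> int) : abs_summable u ->
    series_sum (fun i => u i * eM M (h i)) = \sum_(k < (2 * M).+1)
      (c k * (z ^+ k) ^ M) * series_sum (fun i => u i * (z ^+ k) ^ h i).
  move=> au; apply: has_sumE.
  have hh (k : 'I_(2 * M).+1) := has_sumZ (c k * (z ^+ k) ^ M)
    (abs_summable_has_sum (unr k _ _ h au)).
  apply: has_sum_ext (has_sum_big _ hh) => i /=.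
  by rewrite ex mulr_sumr; apply: eq_bigr => k _; rewrite mulrCA.
rewrite !main //; apply: eq_bigr => k _; congr (_ * _).
exact: (H _ _ P0 (zk k)).
Qed.

End SumTheorems.

(** * Infinite products *)

Section InfiniteProducts.
Variable R : realType.
Implicit Types (c : R[i]) (q : R).

Lemma has_sum_nat (f : nat -> R[i]) s :
  has_sum f s -> (\sum_(0 <= i < n) f i @[n --> \oo] --> s)%classic.
Proof.
move=> /has_sumP fs; apply/cvgcP => e /fs [J HJ].
exists (\max_(k <- J) k).+1 => // n /= Jn.
have := HJ [fset i in index_iota 0 n]%fset; rewrite (perm_big (index_iota 0 n)) /=.
  apply; apply/fsubsetP => k kJ; rewrite in_fset mem_index_iota /=.
  by apply: leq_trans Jn; rewrite ltnS (leq_bigmax_seq k).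
by apply: uniq_perm => [||i]; rewrite ?fset_uniq ?iota_uniq // in_fset.
Qed.

Lemma abs_summable_nat (f : nat -> R[i]) (B t : R) : 0 <= t < 1 ->
  (forall n : nat, normc (f n) <= B * t ^+ n) -> abs_summable f.
Proof.
move=> t01 fB; have /andP[t0 _] := t01.
have B0 : 0 <= B by have := fB 0%N; rewrite expr0 mulr1; apply: le_trans (normc_ge0 _).
pose g (n : int) := if n is Posz m then f m else 0.
apply: (@abs_summable_reindex _ _ _ Posz g) => [? ? []//|].
apply: (abs_summable_int t01) => [n|[|n]]; try exact: fB.
by rewrite [leLHS]normc0 mulr_ge0 // exprn_ge0.
Qed.

Definition qpoch_fin c q (n : nat) : R[i] := \prod_(0 <= j < n) (1 - c * (q ^+ j)%:C).

Lemma qpoch_infE c q l : (qpoch_fin c q n @[n --> \oo] --> l)%classic -> qpoch_inf c q = l.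
Proof. by move=> h; apply/cvg_lim. Qed.

Lemma qpoch_fin0 c q : qpoch_fin c q 0 = 1.
Proof. by rewrite /qpoch_fin big_nil. Qed.

Lemma qpoch_finS c q n : qpoch_fin c q n.+1 = qpoch_fin c q n * (1 - c * (q ^+ n)%:C).
Proof. by rewrite /qpoch_fin big_nat_recr. Qed.

Lemma qpoch_fin_bounded c q n : 0 < q -> q < 1 ->
  normc (qpoch_fin c q n) <= expR (normc c / (1 - q)).
Proof.
move=> q0 q1; have q0' := ltW q0.
apply: le_trans (_ : expR (normc c * \sum_(0 <= j < n) q ^+ j) <= _); last first.
  by rewrite ler_expR ler_wpM2l ?normc_ge0 // geo_sum_le.
elim: n => [|n IH].
  by rewrite /qpoch_fin !big_nil normc1 mulr0 expR0.
rewrite qpoch_finS normcM big_nat_recr //= mulrDr expRD ler_pM ?normc_ge0 //.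
apply: le_trans (normcB _ _) _; rewrite normc1 normcM normc_nneg ?exprn_ge0 ?(ltW q0) //.
exact: expR_ge1Dx.
Qed.

(** Consecutive partial products differ by [c q ^ n] times a bounded factor, so
the telescoping series of differences converges absolutely. *)
Lemma qpoch_inf_cvg c q : 0 < q -> q < 1 ->
  (qpoch_fin c q n @[n --> \oo] --> qpoch_inf c q)%classic.
Proof.
move=> q0 q1; pose D n := qpoch_fin c q n.+1 - qpoch_fin c q n.
have aD : abs_summable D.
  apply: (@abs_summable_nat D (expR (normc c / (1 - q)) * normc c) q).
    by rewrite (ltW q0).
  move=> n; rewrite /D qpoch_finS.
  rewrite [X in normc X](_ : _ = - (qpoch_fin c q n * c * (q ^+ n)%:C)); last by ring.
  rewrite normcNr !normcM normc_nneg ?exprn_ge0 ?(ltW q0) //.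
  rewrite ler_wpM2r ?exprn_ge0 ?(ltW q0) // ler_wpM2r ?normc_ge0 //.
  exact: qpoch_fin_bounded.
have h := has_sum_nat (abs_summable_has_sum aD).
have E : (fun n => \sum_(0 <= i < n) D i) = (fun n => qpoch_fin c q n - 1).
  apply/funext => n; rewrite telescope_sumr //.
  by rewrite [qpoch_fin c q 0]/qpoch_fin big_nil.
rewrite E in h.
have hc : (qpoch_fin c q n @[n --> \oo] --> series_sum D + 1)%classic.
  have E2 : qpoch_fin c q = (fun n => (qpoch_fin c q n - 1) + 1).
    by apply/funext => n; rewrite subrK.
  rewrite E2; exact: (cvgD h (cvg_cst (1 : R[i]))).
by rewrite (qpoch_infE hc).
Qed.
Arguments qpoch_inf_cvg c {q}.

Lemma qpoch_infS c q : 0 < q -> q < 1 ->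
  qpoch_inf c q = (1 - c) * qpoch_inf (c * q%:C) q.
Proof.
move=> q0 q1; apply: qpoch_infE; rewrite -cvg_shiftS.
have -> : (fun n => qpoch_fin c q n.+1) = (fun n => (1 - c) * qpoch_fin (c * q%:C) q n).
  apply/funext => n; rewrite /qpoch_fin big_nat_recl // expr0 mulr1; congr (_ * _).
  by apply: eq_bigr => j _; rewrite exprS rmorphM mulrA.
have h := cvgM (cvg_cst (1 - c)) (qpoch_inf_cvg (c * q%:C) q0 q1).
exact: h.
Qed.

Lemma qpoch_inf_split c q n : 0 < q -> q < 1 ->
  qpoch_inf c q = qpoch_fin c q n * qpoch_inf (c * (q ^+ n)%:C) q.
Proof.
move=> q0 q1; elim: n => [|n IH].
  by rewrite /qpoch_fin big_nil mul1r expr0 mulr1.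
by rewrite IH qpoch_infS // qpoch_finS exprSr rmorphM !mulrA.
Qed.

(** While the partial products stay in the disc of radius 1 about 1, each factor
moves them by at most [2 |c| q ^ j]; the hypothesis on [c] keeps the total of
these moves below 1. *)
Lemma qpoch_inf_near1 c q : 0 < q -> q < 1 -> normc c <= (1 - q) / 2 ->
  normc (qpoch_inf c q - 1) <= 2 / (1 - q) * normc c.
Proof.
move=> q0 q1 cq; have q1' : 0 < 1 - q by rewrite subr_gt0.
have q0' := ltW q0.
have fin n : normc (qpoch_fin c q n - 1) <= 2 * normc c * \sum_(0 <= j < n) q ^+ j.
  elim: n => [|n IH].
    by rewrite /qpoch_fin !big_nil subrr normc0 mulr0.
  have b1 : normc (qpoch_fin c q n - 1) <= 1.
    apply: le_trans IH _.
    apply: le_trans (_ : 2 * ((1 - q) / 2) * (1 - q)^-1 <= _).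
      rewrite ler_pM ?mulr_ge0 ?normc_ge0 ?geo_sum_le ?ler_wpM2l //.
      by rewrite sumr_ge0 // => j _; rewrite exprn_ge0 // ltW.
    by rewrite mulrCA mulfV // mulr1 mulfV // gt_eqF.
  have b2 : normc (qpoch_fin c q n) <= 2.
    rewrite -[qpoch_fin c q n](subrK 1) (le_trans (normcD _ _)) // normc1.
    by rewrite -[leRHS](_ : 1 + 1 = _) ?lerD2r.
  rewrite qpoch_finS big_nat_recr //= [leRHS]mulrDr.
  rewrite [X in normc X](_ : _ = (qpoch_fin c q n - 1) -
    (qpoch_fin c q n * (c * (q ^+ n)%:C))); last by ring.
  rewrite (le_trans (normcB _ _)) // lerD // !normcM.
  rewrite normc_nneg ?exprn_ge0 ?(ltW q0) // mulrA.
  by rewrite ler_wpM2r ?exprn_ge0 ?(ltW q0) // ler_wpM2r ?normc_ge0.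
have h : (normc (qpoch_fin c q n - 1) @[n --> \oo] --> normc (qpoch_inf c q - 1))%classic.
  apply: cvgc_normc; exact: (cvgB (qpoch_inf_cvg c q0 q1) (cvg_cst (1 : R[i]))).
apply: (cvgr_to_le h); apply: nearW => n.
apply: le_trans (fin n) _.
rewrite [leRHS](_ : _ = 2 * normc c * (1 - q)^-1); last by ring.
by rewrite ler_wpM2l ?mulr_ge0 ?normc_ge0 // geo_sum_le.
Qed.

Lemma cvg_geo q : 0 < q -> q < 1 -> (q ^+ n @[n --> \oo] --> 0)%classic.
Proof. by move=> q0 q1; apply: cvg_expr; rewrite ger0_norm // ltW. Qed.

Lemma qpoch_inf_tail c q : 0 < q -> q < 1 ->
  (qpoch_inf (c * (q ^+ n)%:C) q @[n --> \oo] --> (1 : R[i]))%classic.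
Proof.
move=> q0 q1; have q1' : 0 < 1 - q by rewrite subr_gt0.
apply/cvgcP => e e0.
(* The two bounds in the minimum serve the hypothesis and the conclusion of
   [qpoch_inf_near1]. *)
pose d := Num.min ((1 - q) / 2) (e * (1 - q) / 4) / (normc c + 1).
have c0 : 0 < normc c + 1 by rewrite ltr_wpDl ?normc_ge0.
have d0 : 0 < d by rewrite divr_gt0 // lt_min !divr_gt0 // mulr_gt0.
have /cvgrPdist_lt/(_ _ d0) := cvg_geo q0 q1; apply: filterS => n.
rewrite sub0r normrN ger0_norm ?exprn_ge0 ?(ltW q0) // => hn.
have : normc (c * (q ^+ n)%:C) <= Num.min ((1 - q) / 2) (e * (1 - q) / 4).
  rewrite normcM normc_nneg ?exprn_ge0 ?(ltW q0) //.
  move: hn; rewrite ltr_pdivlMr // => /ltW; apply: le_trans; rewrite mulrC.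
  by rewrite ler_wpM2l ?exprn_ge0 ?(ltW q0) // lerDl.
rewrite le_min => /andP[h1 h2].
apply: le_lt_trans (qpoch_inf_near1 q0 q1 h1) _.
apply: le_lt_trans (_ : 2 / (1 - q) * (e * (1 - q) / 4) < _).
  by rewrite ler_wpM2l // divr_ge0 // ltW.
rewrite [ltLHS](_ : _ = e / 2); last by field; rewrite gt_eqF.
by rewrite ltr_pdivrMr // ltr_pMr // ltr1n.
Qed.
Arguments qpoch_inf_tail c {q}.

(** A tail of the product is close to 1, and the finitely many factors before it
do not vanish. *)
Lemma qpoch_inf_neq0 c q : 0 < q -> q < 1 ->
  (forall j : nat, c * (q ^+ j)%:C != 1) -> qpoch_inf c q != 0.
Proof.
move=> q0 q1 cq; have := qpoch_inf_tail c q0 q1.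
move=> /cvgcP/(_ 1 ltr01) [n _ /(_ n (leqnn _)) h].
rewrite (qpoch_inf_split c n q0 q1) mulf_neq0 //.
  rewrite /qpoch_fin; elim: n {h} => [|n IH]; first by rewrite big_nil oner_neq0.
  by rewrite big_nat_recr //= mulf_neq0 // subr_eq0 eq_sym.
by apply: contraTneq h => ->; rewrite sub0r normcNr normc1 ltxx.
Qed.

Lemma qpoch_inf_neq0_small c q : 0 < q -> q < 1 -> normc c < 1 -> qpoch_inf c q != 0.
Proof.
move=> q0 q1 c1; apply: qpoch_inf_neq0 => // j.
apply: contraTneq c1 => /(congr1 (@normc R)).
rewrite normcM normc1 normc_nneg ?exprn_ge0 ?(ltW q0) // => h.
by rewrite -leNgt -h ler_piMr ?normc_ge0 // exprn_ile1 // ltW.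
Qed.

(** The factorization [1 - t ^+ p = \prod_w (1 - w t)] over the [p]-th roots of
unity [w], applied to every factor of the infinite product. *)
Lemma qpoch_inf_roots c q (p : nat) (ws : seq R[i]) : 0 < q -> q < 1 -> (0 < p)%N ->
  (forall t, \prod_(w <- ws) (1 - w * t) = 1 - t ^+ p) ->
  qpoch_inf (c ^+ p) (q ^+ p) = \prod_(w <- ws) qpoch_inf (w * c) q.
Proof.
move=> q0 q1 p0 H; apply: qpoch_infE.
have -> : (fun n => qpoch_fin (c ^+ p) (q ^+ p) n) =
    (fun n => \prod_(w <- ws) qpoch_fin (w * c) q n).
  apply/funext => n; rewrite /qpoch_fin exchange_big /=; apply: eq_bigr => j _.
  rewrite -exprM mulnC exprM rmorphXn -exprMn -H.
  by apply: eq_bigr => w _; rewrite mulrA.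
elim: ws {H} => [|w ws IH].
  rewrite big_nil; under eq_fun do rewrite big_nil; exact: cvg_cst.
rewrite big_cons; under eq_fun do rewrite big_cons.
exact: (cvgM (qpoch_inf_cvg (w * c) q0 q1) IH).
Qed.

End InfiniteProducts.

Arguments qpoch_inf_cvg {R} c {q}.
Arguments qpoch_inf_tail {R} c {q}.

(** * Quotients of q-shifted factorials *)

Section Coefficients.
Variable R : realType.
Variable q : R.
Hypotheses (q_gt0 : 0 < q) (q_lt1 : q < 1).
Implicit Types a b c x : R[i].

Let q_neq0 : q != 0. Proof. by rewrite gt_eqF. Qed.

(** These say that no factor [1 - a q ^ (- k)] with [k >= 1], respectively
[1 - b q ^ k] with [k >= 0], is zero. *)
Definition num_regular (a : R[i]) : Prop := forall k : nat, (1 <= k)%N -> a != (q ^+ k)%:C.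
Definition den_regular (b : R[i]) : Prop := forall k : nat, b != (q ^- k)%:C.

Definition qz (n : int) : R[i] := (q ^ n)%:C.

Lemma qzD (m n : int) : qz (m + n) = qz m * qz n.
Proof. by rewrite /qz expfzDr // rmorphM. Qed.

Lemma qz0 : qz 0 = 1.
Proof. by rewrite /qz expr0z. Qed.

Lemma qz1 : qz 1 = q%:C.
Proof. by rewrite /qz expr1z. Qed.

Lemma qz_neq0 (n : int) : qz n != 0.
Proof. by rewrite -normc_eq0 normc_real normr_eq0 expfz_neq0. Qed.

Lemma qzK (n : int) : qz n * qz (- n) = 1.
Proof. by rewrite -qzD subrr qz0. Qed.

Lemma qC_neq0 : q%:C != 0 :> R[i].
Proof. by rewrite -qz1 qz_neq0. Qed.

Lemma num_regularP a (n : int) : num_regular a -> n < 0 -> 1 - a * qz n != 0.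
Proof.
case: n => n // ha _; rewrite subr_eq0 eq_sym.
apply: contra (ha n.+1 isT) => /eqP h.
by rewrite -[a]mulr1 -(qzK (Negz n)) mulrA h mul1r NegzE opprK /qz.
Qed.

Lemma den_regularP b (n : int) : den_regular b -> 0 <= n -> 1 - b * qz n != 0.
Proof.
case: n => n // hb _; rewrite subr_eq0 eq_sym.
apply: contra (hb n) => /eqP h.
by rewrite -[b]mulr1 -(qzK n) mulrA h mul1r /qz -exprnN.
Qed.

Lemma den_regular_shift b : den_regular b -> den_regular (b * q%:C).
Proof.
move=> hb k; have := hb k.+1; apply: contra => /eqP h; apply/eqP.
apply: (mulIf qC_neq0); rewrite h -rmorphM /=; congr (_%:C).
by rewrite exprS invfM mulrC mulrA mulfV // mul1r.
Qed.

Lemma num_regular_unshift a : num_regular (a * q%:C) -> num_regular a.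
Proof.
move=> ha k k1; have := ha k.+1 isT; apply: contra => /eqP ->.
by rewrite -rmorphM exprSr.
Qed.

Lemma den_regular0 : den_regular 0.
Proof.
move=> k; rewrite eq_sym -normc_eq0 normc_real normr_eq0.
by rewrite invr_eq0 expf_neq0.
Qed.

Lemma den_regular_qX (k : nat) : (0 < k)%N -> den_regular (q ^+ k)%:C.
Proof.
move=> k0 j; apply/eqP => /complexI h.
have : q ^+ k < q ^- j.
  apply: (lt_le_trans (y := 1)); first by rewrite exprn_ilt1 // ?ltW // -lt0n.
  by rewrite invf_ge1 ?exprn_gt0 // exprn_ile1 // ltW.
by rewrite h ltxx.
Qed.

Lemma qpochS_nat c (n : nat) : qpoch c q (n%:Z + 1) = qpoch c q n * (1 - c * qz n).
Proof. by rewrite -PoszD addn1 /= big_nat_recr. Qed.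

(** Stated for inverses, so that it also holds when a factor vanishes and
[qpoch c q] takes the value [0^-1 = 0]. *)
Lemma qpochS_neg c (n : nat) :
  (qpoch c q (Negz n))^-1 = (qpoch c q (Negz n + 1))^-1 * (1 - c * qz (Negz n)).
Proof.
rewrite /= invrK big_nat_recr //=; congr (_ * _); last first.
case: n => [|n].
  by rewrite [(Negz 0 + 1)%R](_ : _ = 0) //= !big_geq // invr1.
by rewrite [(Negz n.+1 + 1)%R](_ : _ = Negz n) /= ?invrK //; lia.
Qed.

Definition coef a b (n : int) : R[i] := qpoch a q n / qpoch b q n.

Lemma coef0 a b : coef a b 0 = 1.
Proof. by rewrite /coef /= !big_geq // divr1. Qed.

(** This two-term recursion determines [coef] up to a constant factor, so the
relations between coefficients for shifted parameters follow from it. For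
[b = q ^ k] with [k >= 1] it remains true because the coefficients of index at
most [- k] are all zero. *)
Lemma coef_rec a b (n : int) : num_regular a -> den_regular b ->
  coef a b n * (1 - a * qz n) = coef a b (n + 1) * (1 - b * qz n).
Proof.
move=> ha hb; rewrite /coef; case: n => n.
  rewrite !qpochS_nat invfM mulrA -[RHS]mulrA mulVf ?mulr1; first by rewrite mulrAC.
  exact: den_regularP.
rewrite qpochS_neg.
have := qpochS_neg a n; have h : 1 - a * qz (Negz n) != 0 by exact: num_regularP.
move=> /(congr1 GRing.inv); rewrite invrK invfM invrK => ->.
rewrite -!mulrA; congr (_ * _).
by rewrite mulrC -!mulrA mulfV // mulr1.
Qed.

Lemma oppz_succ (n : nat) : - n%:Z = - n.+1%:Z + 1.
Proof. by lia. Qed.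

Lemma coef_rec_eq a b (m n : int) : num_regular a -> den_regular b -> m = n + 1 ->
  coef a b n * (1 - a * qz n) = coef a b m * (1 - b * qz n).
Proof. by move=> ha hb ->; exact: coef_rec. Qed.

(** Upward steps divide by [d n] with [n >= 0], downward steps by [c n] with
[n < 0]; these are exactly the factors that the regularity conditions keep
away from zero. *)
Lemma rec_unique (f g c d : int -> R[i]) :
  (forall n, f n * c n = f (n + 1) * d n) -> (forall n, g n * c n = g (n + 1) * d n) ->
  (forall n, n < 0 -> c n != 0) -> (forall n, 0 <= n -> d n != 0) ->
  f 0 = g 0 -> f =1 g.
Proof.
move=> hf hg hc hd h0; elim/int_rect => [//|n IH|n IH].
  apply: (mulIf (hd n isT)); rewrite -addn1 PoszD -hf -hg.
  by rewrite IH.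
have e : - n.+1%:Z + 1 = - n%:Z by lia.
apply: (mulIf (hc (- n.+1%:Z) _)) => //; by rewrite hf hg e IH.
Qed.

Lemma coef_unique a b (f : int -> R[i]) : num_regular a -> den_regular b ->
  (forall n, f n * (1 - a * qz n) = f (n + 1) * (1 - b * qz n)) ->
  forall n, f n = f 0 * coef a b n.
Proof.
move=> ha hb hf; apply: (rec_unique hf) => [n|n n0|n n0|].
- by rewrite -mulrA coef_rec // mulrA.
- exact: num_regularP.
- exact: den_regularP.
- by rewrite coef0 mulr1.
Qed.

Lemma coef_shift a b (n : int) : num_regular (a * q%:C) -> den_regular b ->
  coef a b (n + 1) * (1 - b) = (1 - a) * coef (a * q%:C) (b * q%:C) n.
Proof.
move=> ha hb; have hb' := den_regular_shift hb; have ha' := num_regular_unshift ha.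
have e z m : z * q%:C * qz m = z * qz (m + 1) by rewrite addrC qzD qz1 mulrA.
rewrite (coef_unique (f := fun n => coef a b (n + 1) * (1 - b)) ha hb') => [|m].
  by have := coef_rec 0 ha' hb; rewrite coef0 qz0 !mulr1 mul1r => <-.
by rewrite !e mulrAC coef_rec // mulrAC.
Qed.

Lemma coef_shift_den a b (n : int) : num_regular a -> den_regular b ->
  coef a (b * q%:C) n * (1 - b * qz n) = (1 - b) * coef a b n.
Proof.
move=> ha hb; have hb' := den_regular_shift hb.
rewrite (coef_unique (f := fun n => coef a (b * q%:C) n * (1 - b * qz n)) ha hb).
  by rewrite coef0 mul1r qz0 mulr1.
move=> m; rewrite mulrAC coef_rec //.
by rewrite addrC qzD qz1 mulrA.
Qed.

(** This is [(b; q)_n (b q ^ n; q)_inf = (b; q)_inf] without division: the right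
side is an entire function of [b]. *)
Lemma coef_qpoch_inf a b (n : int) : num_regular a -> den_regular b ->
  qpoch_inf b q * coef a b n = coef a 0 n * qpoch_inf (b * qz n) q.
Proof.
move=> ha hb; apply/esym.
rewrite (coef_unique (f := fun n => coef a 0 n * qpoch_inf (b * qz n) q) ha hb).
  by rewrite coef0 mul1r qz0 mulr1.
move=> m; rewrite mulrAC coef_rec //; last exact: den_regular0.
rewrite mul0r subr0 mulr1 [qpoch_inf (b * qz m) q]qpoch_infS //.
by rewrite qzD qz1 mulrA (mulrC (1 - _)) mulrA.
Qed.

(** The denominator [(q; q)_n] with [n < 0] has a factor [1 - q q ^ (-1)]. *)
Lemma coef_q_neg a (n : nat) : num_regular a -> coef a q%:C (Negz n) = 0.
Proof.
move=> ha; rewrite /coef; suff -> : (qpoch q%:C q (Negz n))^-1 = 0 by rewrite mulr0.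
rewrite /= invrK big_nat_recl // expr1 -rmorphM mulfV //.
by rewrite rmorph1 subrr mul0r.
Qed.

(** The ratio test: an eventual ratio below [t] gives geometric growth. *)
Lemma ratio_bound (u c d : nat -> R) (C D t : R) :
  (forall n : nat, 0 <= u n) -> (forall n : nat, 0 <= d n) -> 0 < t ->
  (c n @[n --> \oo] --> C)%classic -> (d n @[n --> \oo] --> D)%classic -> D < t * C ->
  (forall n : nat, c n * u n.+1 <= d n * u n) ->
  exists B : R, forall n : nat, u n <= B * t ^+ n.
Proof.
move=> u0 d0 t0 cC dD DC H.
have [N _ HN] : (\forall n \near \oo, d n < t * c n)%classic.
  have h : (t * c n - d n @[n --> \oo] --> t * C - D)%classic.
    exact: (cvgB (cvgM (cvg_cst t) cC) dD).
  have h0 : 0 < t * C - D by rewrite subr_gt0.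
  have : (\forall n \near \oo, 0 < t * c n - d n)%classic by exact: (cvgr_gt _ h 0 h0).
  by apply: filterS => n; rewrite subr_gt0.
have step (n : nat) : (N <= n)%N -> u n.+1 <= t * u n.
  move=> Nn; have h := HN n Nn; have cn : 0 < c n.
    by rewrite -(pmulr_rgt0 _ t0) (le_lt_trans (d0 n)).
  rewrite -(ler_pM2l cn) (le_trans (H n)) // mulrA (mulrC (c n)).
  by rewrite ler_wpM2r // ltW.
pose B := \sum_(0 <= k < N.+1) u k / t ^+ k; exists B.
have tn (n : nat) : 0 < t ^+ n by rewrite exprn_gt0.
have small (n : nat) : (n <= N)%N -> u n <= B * t ^+ n.
  move=> nN; rewrite -ler_pdivrMr //.
  rewrite /B (big_rem n) ?mem_index_iota //= lerDl sumr_ge0 // => k _.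
  by rewrite divr_ge0 // ltW.
move=> n; have [/small//|/ltnW Nn] := leqP n N.
rewrite -(subnK Nn); elim: (n - N)%N => [|k IH]; first by rewrite add0n small.
rewrite addSn (le_trans (step _ _)) ?leq_addl //.
by rewrite exprS mulrCA ler_wpM2l // ltW.
Qed.

Lemma cvg_qX_scale c : (c * (q ^+ n)%:C @[n --> \oo] --> (0 : R[i]))%classic.
Proof.
apply/cvgcP => e e0; have d0 : 0 < e / (normc c + 1).
  by rewrite divr_gt0 // ltr_wpDl ?normc_ge0.
have /cvgrPdist_lt/(_ _ d0) := cvg_geo q_gt0 q_lt1; apply: filterS => n.
rewrite sub0r normrN ger0_norm ?exprn_ge0 ?(ltW q_gt0) // subr0 normcM.
rewrite normc_nneg ?exprn_ge0 ?(ltW q_gt0) // ltr_pdivlMr; last first.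
  by rewrite ltr_wpDl ?normc_ge0.
by apply: le_lt_trans; rewrite mulrC ler_wpM2l ?exprn_ge0 ?(ltW q_gt0) // lerDl.
Qed.
Arguments cvg_qX_scale c : clear implicits.

Lemma cvg_normc_num c : (normc (1 - c * (q ^+ n)%:C) @[n --> \oo] --> (1 : R))%classic.
Proof.
have h : (1 - c * (q ^+ n)%:C @[n --> \oo] --> 1 - (0 : R[i]))%classic.
  exact: (cvgB (cvg_cst (1 : R[i])) (cvg_qX_scale c)).
by rewrite subr0 in h; rewrite -(normc1 R); exact: cvgc_normc h.
Qed.
Arguments cvg_normc_num c : clear implicits.

Lemma cvg_normc_shift c : (normc ((q ^+ n.+1)%:C - c) @[n --> \oo] --> normc c)%classic.
Proof.
have h : (q%:C * (q ^+ n)%:C - c @[n --> \oo] --> (0 : R[i]) - c)%classic.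
  exact: (cvgB (cvg_qX_scale q%:C) (cvg_cst c)).
rewrite sub0r in h; rewrite -(normcNr c).
have -> : (fun n => normc ((q ^+ n.+1)%:C - c)) =
    (fun n => normc (q%:C * (q ^+ n)%:C - c)).
  by apply/funext => n; rewrite exprS rmorphM.
exact: cvgc_normc h.
Qed.
Arguments cvg_normc_shift c : clear implicits.

(** The ratio of consecutive coefficients of index [n] and [n + 1] tends to
[b / a] as [n] tends to [-oo], and to 1 as [n] tends to [+oo]; hence convergence
in the annulus. *)
Lemma coef_summable a b x : num_regular a -> den_regular b -> a != 0 ->
  normc (b / a) < normc x -> normc x < 1 -> abs_summable (fun n => coef a b n * x ^ n).
Proof.
move=> ha hb a0 bx x1; set u := fun n : int => _.
have x0 : 0 < normc x := le_lt_trans (normc_ge0 _) bx.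
have xn0 : x != 0 by rewrite -normc_gt0.
have na0 : 0 < normc a by rewrite normc_gt0.
have [s s0 s1] : exists2 s, normc x < s & s < 1.
  by exists ((normc x + 1) / 2); lra.
have [B1 H1] : exists B, forall n : nat, normc (u n) <= B * s ^+ n.
  apply: (@ratio_bound (fun n : nat => normc (u n)) (fun n => normc (1 - b * qz n))
    (fun n => normc (1 - a * qz n) * normc x) 1 (normc x) s) => //.
  - by move=> n; exact: normc_ge0.
  - by move=> n; rewrite mulr_ge0 ?normc_ge0.
  - exact: lt_trans s0.
  - exact: cvg_normc_num.
  - have h := cvgM (cvg_normc_num a) (cvg_cst (normc x)).
    rewrite mul1r in h; exact: h.
  - by rewrite mulr1.
  - move=> n; rewrite -!normcM le_eqVlt; apply/orP; left; apply/eqP; congr normc.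
    rewrite /u -addn1 PoszD expfzDr // expr1z.
    by rewrite mulrA (mulrC (1 - _)) -coef_rec //; ring.
have [t t0 t1] : exists2 t, normc (b / a) / normc x < t & t < 1.
  exists ((normc (b / a) / normc x + 1) / 2).
    have : normc (b / a) / normc x < 1 by rewrite ltr_pdivrMr // mul1r.
    lra.
  have : normc (b / a) / normc x < 1 by rewrite ltr_pdivrMr // mul1r.
  lra.
have t0' : 0 < t by apply: le_lt_trans t0; rewrite divr_ge0 ?normc_ge0.
(* Multiplying the recursion at - n - 1 by q ^ (n + 1) makes both of its
   coefficients convergent. *)
have [B2 H2] : exists B, forall n : nat, normc (u (- n%:Z)) <= B * t ^+ n.
  apply: (@ratio_bound (fun n : nat => normc (u (- n%:Z)))
    (fun n => normc ((q ^+ n.+1)%:C - a) * normc x)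
    (fun n => normc ((q ^+ n.+1)%:C - b)) (normc a * normc x) (normc b) t) => //.
  - by move=> n; exact: normc_ge0.
  - by move=> n; exact: normc_ge0.
  - have h := cvgM (cvg_normc_shift a) (cvg_cst (normc x)).
    exact: h.
  - exact: cvg_normc_shift.
  - move: t0; rewrite normcM normcV ltr_pdivrMr // ltr_pdivrMr //.
    by rewrite -mulrA (mulrC (normc a)).
  - move=> n; rewrite -!normcM le_eqVlt; apply/orP; left; apply/eqP; congr normc.
    have := coef_rec_eq ha hb (oppz_succ n).
    have ex : x ^ (- n%:Z) = x ^ (- n.+1%:Z) * x.
      by rewrite -[X in _ * X]expr1z -expfzDr // -oppz_succ.
    rewrite /u ex.
    have := qzK n.+1; rewrite [qz n.+1]/qz -exprnP.
    move: (qz _) (x ^ _) (coef a b _) (coef a b _) (_%:C) => z y A2 A1 w wz h.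
    have -> : w - a = w * (1 - a * z) by rewrite mulrBr mulr1 mulrCA wz mulr1.
    have -> : w - b = w * (1 - b * z) by rewrite mulrBr mulr1 mulrCA wz mulr1.
    transitivity (w * x * y * (A1 * (1 - a * z))); first by ring.
    by rewrite h; ring.
pose m := Num.max s t; pose B := Num.max B1 B2.
have s0' : 0 < s by exact: lt_trans s0.
have m0 : 0 < m by rewrite lt_max s0'.
have B10 : 0 <= B1 by have := H1 0%N; rewrite expr0 mulr1; apply: le_trans (normc_ge0 _).
have B20 : 0 <= B2 by have := H2 0%N; rewrite expr0 mulr1; apply: le_trans (normc_ge0 _).
apply: (@abs_summable_int _ _ B m); first by rewrite (ltW m0) gt_max s1 t1.
- move=> n; apply: le_trans (H1 n) _; apply: ler_pM => //.
  + by rewrite exprn_ge0 // ltW.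
  + by rewrite le_max lexx.
  + by rewrite lerXn2r ?nnegrE ?(ltW m0) ?(ltW s0') // le_max lexx.
- move=> n; apply: le_trans (H2 n) _; apply: ler_pM => //.
  + by rewrite exprn_ge0 // ltW.
  + by rewrite le_max lexx orbT.
  + by rewrite lerXn2r ?nnegrE ?(ltW m0) ?(ltW t0') // le_max lexx orbT.
Qed.

End Coefficients.

(** * Ramanujan's 1psi1 summation *)

Section Ramanujan.
Variable R : realType.
Variable q : R.
Hypotheses (q_gt0 : 0 < q) (q_lt1 : q < 1).
Implicit Types a b c x y : R[i].

Local Notation P c := (qpoch_inf c q).
Local Notation Q := (q%:C : R[i]).

Definition psi a b x : R[i] := series_sum (fun n : int => coef q a b n * x ^ n).

Lemma qzE (n : int) : qz q n = Q ^ n.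
Proof.
by case: n => n; rewrite /qz ?NegzE -?exprnN -?exprnP ?fmorphV rmorphXn.
Qed.

Lemma has_sum_succ (f : int -> R[i]) s : has_sum f s -> has_sum (fun n => f (n + 1)) s.
Proof.
apply: (@has_sum_reindex R int int (fun n => n + 1) (fun n => n - 1)) => n.
  by rewrite addrK.
by rewrite subrK.
Qed.

Lemma psi_has_sum a b x : num_regular q a -> den_regular q b -> a != 0 ->
  normc (b / a) < normc x -> normc x < 1 ->
  has_sum (fun n => coef q a b n * x ^ n) (psi a b x).
Proof. by move=> *; apply: abs_summable_has_sum; exact: coef_summable. Qed.

Lemma normc_scale_q c (k : nat) : normc (c * (q ^+ k)%:C) <= normc c.
Proof.
rewrite normcM normc_nneg ?exprn_ge0 ?(ltW q_gt0) // ler_piMr ?normc_ge0 //.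
by rewrite exprn_ile1 // ltW.
Qed.

(** In terms of the coefficients W_n for [(a, b q)], the series for [(a, b)] has
terms [(1 - b q ^ n) W_n x ^ n / (1 - b)]. Subtracting [b / (a x)] times its
shift by one index, the recursion for W_n cancels all dependence on [q ^ n]. *)
Lemma psi_shift_den a b x : num_regular q a -> den_regular q b -> a != 0 ->
  normc (b / a) < normc x -> normc x < 1 ->
  (1 - b) * (1 - b / (a * x)) * psi a b x = (1 - b / a) * psi a (b * Q) x.
Proof.
move=> ha hb a0 bx x1; have hb' := den_regular_shift q_gt0 hb.
have x0 : x != 0 by rewrite -normc_gt0 (le_lt_trans (normc_ge0 _) bx).
have bx' : normc (b * Q / a) < normc x.
  apply: le_lt_trans bx; rewrite mulrAC -(expr1 q); exact: normc_scale_q.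
pose W n := coef q a (b * Q) n.
have h1 : has_sum (fun n => (1 - b * qz q n) * W n * x ^ n) ((1 - b) * psi a b x).
  apply: has_sum_ext (has_sumZ (1 - b) (psi_has_sum ha hb a0 bx x1)) => n.
  by rewrite mulrA -coef_shift_den // (mulrC (coef _ _ _ _)).
have h2 := has_sumB h1 (has_sumZ (b / (a * x)) (has_sum_succ h1)).
have h3 := has_sumZ (1 - b / a) (psi_has_sum ha hb' a0 bx' x1).
have -> : (1 - b) * (1 - b / (a * x)) * psi a b x =
  (1 - b) * psi a b x - b / (a * x) * ((1 - b) * psi a b x) by ring.
apply: has_sum_unique h3; apply: has_sum_ext h2 => n.
have := coef_rec q_gt0 q_lt1 n ha hb'.
have -> : b * Q * qz q n = b * qz q (n + 1) by rewrite addrC qzD // qz1 mulrA.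
rewrite -/(W n) -/(W (n + 1)) expfzDr // expr1z.
move: (W n) (W (n + 1)) (qz q n) (qz q (n + 1)) (x ^ n) => w w1 z z1 y h.
have -> : b / (a * x) * ((1 - b * z1) * w1 * (y * x)) = b / a * (w1 * (1 - b * z1)) * y.
  by field; rewrite a0.
by rewrite -h; field.
Qed.

(** Domination of [(c; q)_inf] by the product with all factors enlarged to
[1 + r q ^ j]. *)
Lemma qpoch_inf_normc_le c (r : R) : normc c <= r -> normc (P c) <= normc (P (- r%:C)).
Proof.
move=> cr; have r0 : 0 <= r by apply: le_trans cr; exact: normc_ge0.
have fin n : normc (qpoch_fin c q n) <= normc (qpoch_fin (- r%:C) q n).
  rewrite /qpoch_fin !normc_prod; apply: ler_prod => j _; rewrite normc_ge0 /=.
  have qj : 0 <= q ^+ j by rewrite exprn_ge0 // ltW.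
  have rE : normc (1 - - r%:C * (q ^+ j)%:C) = 1 + r * q ^+ j.
    rewrite mulNr opprK -rmorphM -(rmorph1 (real_complex R)) -rmorphD.
    by rewrite normc_nneg ?addr_ge0 ?mulr_ge0.
  rewrite [leRHS]rE.
  rewrite (le_trans (normcB _ _)) // normc1 lerD2l normcM normc_nneg //.
  by rewrite ler_wpM2r.
have h1 := cvgc_normc (qpoch_inf_cvg c q_gt0 q_lt1).
have h2 := cvgc_normc (qpoch_inf_cvg (- r%:C) q_gt0 q_lt1).
apply: (ler_cvg_to h1 h2); exact: nearW.
Qed.

Lemma den_regular_neg (r : R) : 0 <= r -> den_regular q (- r%:C).
Proof.
move=> r0 k; apply/eqP; rewrite -rmorphN => /complexI h.
have : 0 < q ^- k by rewrite invr_gt0 exprn_gt0.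
by rewrite -h oppr_gt0 ltNge r0.
Qed.

(** [psi a b x * (b; q)_inf] is the sum of the entire functions
[b |-> (a; q)_n (b q ^ n; q)_inf x ^ n], so it is continuous at [b = 0]. *)
Lemma psi_den_tail a b x : num_regular q a -> den_regular q b -> a != 0 ->
  normc (b / a) < normc x -> normc x < 1 ->
  (psi a (b * (q ^+ n)%:C) x * P (b * (q ^+ n)%:C) @[n --> \oo] --> psi a 0 x)%classic.
Proof.
move=> ha hb a0 bx x1.
have hbn n : den_regular q (b * (q ^+ n)%:C).
  elim: n => [|n IH]; first by rewrite expr0 mulr1.
  by rewrite exprSr rmorphM mulrA; exact: den_regular_shift.
have bxn n : normc (b * (q ^+ n)%:C / a) < normc x.
  by apply: le_lt_trans bx; rewrite mulrAC; exact: normc_scale_q.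
pose F n (m : int) := coef q a 0 m * P (b * qz q m * (q ^+ n)%:C) * x ^ m.
have E n : psi a (b * (q ^+ n)%:C) x * P (b * (q ^+ n)%:C) = series_sum (F n).
  apply/esym/has_sumE; rewrite mulrC.
  apply: has_sum_ext (has_sumZ (P _) (psi_has_sum ha (hbn n) a0 (bxn n) x1)) => m.
  by rewrite mulrA coef_qpoch_inf // /F [b * qz q m * _]mulrAC.
(* The dominating series is again of the same kind, with b replaced by - |b|. *)
rewrite (funext E); pose b' : R[i] := - (normc b)%:C.
have hb' : den_regular q b' by apply: den_regular_neg; exact: normc_ge0.
apply: (@series_sum_dominated R int F _ (fun m => P b' * (coef q a b' m * x ^ m))).
- apply: abs_summableZ; apply: coef_summable => //.
  by rewrite normcM normcNr normc_nneg ?normc_ge0 // -normcM.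
- move=> n m; rewrite mulrA coef_qpoch_inf // /F normcM [leRHS]normcM.
  rewrite ler_wpM2r ?normc_ge0 // normcM [leRHS]normcM ler_wpM2l ?normc_ge0 //.
  rewrite /b' mulNr -rmorphM.
  apply: qpoch_inf_normc_le; rewrite (le_trans (normc_scale_q _ _)) //.
  rewrite normcM normc_nneg // /qz exprz_ge0 //; exact: ltW.
- move=> m; rewrite /F.
  have h := cvgM (cvgM (cvg_cst (coef q a 0 m)) (qpoch_inf_tail (b * qz q m) q_gt0 q_lt1))
    (cvg_cst (x ^ m)).
  rewrite mulr1 in h; exact: h.
Qed.

(** Iterating the shift [b -> b q] and letting the denominator parameter tend
to [0] isolates the dependence on [b]. *)
Lemma psi_den_factor a b x : num_regular q a -> den_regular q b -> a != 0 ->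
  normc (b / a) < normc x -> normc x < 1 ->
  psi a b x * P b * P (b / (a * x)) = P (b / a) * psi a 0 x.
Proof.
move=> ha hb a0 bx x1; pose bn n := b * (q ^+ n)%:C.
have hbn n : den_regular q (bn n).
  elim: n => [|n IH]; first by rewrite /bn expr0 mulr1.
  by rewrite /bn exprSr rmorphM mulrA; exact: den_regular_shift.
have bxn n : normc (bn n / a) < normc x.
  by apply: le_lt_trans bx; rewrite mulrAC; exact: normc_scale_q.
pose D c := psi a c x * P c * P (c / (a * x)).
have bnS n : bn n.+1 = bn n * Q by rewrite /bn exprSr rmorphM mulrA.
have step n : D b = qpoch_fin (b / a) q n * D (bn n).
  elim: n => [|n IH]; first by rewrite qpoch_fin0 mul1r /bn expr0 mulr1.
  rewrite IH qpoch_finS -mulrA; congr (_ * _); rewrite /D.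
  rewrite [P (bn n)]qpoch_infS // [P (bn n / _)]qpoch_infS //.
  rewrite -bnS [bn n / _ * Q]mulrAC -bnS.
  have -> : b / a * (q ^+ n)%:C = bn n / a by rewrite mulrAC.
  have := psi_shift_den ha (hbn n) a0 (bxn n) x1; rewrite -bnS => h.
  rewrite !mulrA -h; ring.
have lim : (qpoch_fin (b / a) q n * D (bn n) @[n --> \oo] -->
    P (b / a) * (psi a 0 x * 1))%classic.
  have h1 := psi_den_tail ha hb a0 bx x1.
  have h2 := qpoch_inf_tail (b / (a * x)) q_gt0 q_lt1.
  have e n : D (bn n) = psi a (bn n) x * P (bn n) * P (b / (a * x) * (q ^+ n)%:C).
    by rewrite /D [bn n / (a * x)]mulrAC.
  rewrite (funext (fun n => congr1 ( *%R (qpoch_fin (b / a) q n)) (e n))).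
  exact: (cvgM (qpoch_inf_cvg (b / a) q_gt0 q_lt1) (cvgM h1 h2)).
rewrite -(funext step) mulr1 in lim.
exact: (cvg_unique _ (cvg_cst (D b)) lim).
Qed.

Lemma has_sum_delta (f : int -> R[i]) : (forall n, n != 0 -> f n = 0) -> has_sum f (f 0).
Proof.
move=> f0; apply/has_sumP => e e0; exists [fset 0]%fset => K; rewrite fsub1set => K0.
rewrite (big_fsetD1 0) //= big_seq big1 ?addr0 ?subrr ?normc0 // => n.
by rewrite !inE => /andP[n0 _]; exact: f0.
Qed.

(** The q-binomial theorem: for [b = q] the terms of negative index vanish. *)
Lemma q_binomial a x : num_regular q a -> a != 0 ->
  normc (Q / a) < normc x -> normc x < 1 -> psi a Q x * P x = P (a * x).
Proof.
move=> ha a0 qx x1.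
have hq : den_regular q Q by have := @den_regular_qX R q q_gt0 q_lt1 1; rewrite expr1; apply.
have x0 : x != 0 by rewrite -normc_gt0 (le_lt_trans (normc_ge0 _) qx).
have summ := coef_summable q_gt0 q_lt1 ha hq a0 qx x1.
pose xn n := x * (q ^+ n)%:C.
have xnS n : xn n.+1 = xn n * Q by rewrite /xn exprSr rmorphM mulrA.
have xn0 n : xn n != 0 by rewrite mulf_neq0 // -[_%:C]/(qz q n) qz_neq0.
have xnSz n (m : int) : xn n.+1 ^ m = xn n ^ m * qz q m.
  by rewrite xnS exprzMl ?unitfE ?qC_neq0 // qzE.
have dom n m : normc (coef q a Q m * xn n ^ m) <= normc (coef q a Q m * x ^ m).
  case: m => m; last by rewrite coef_q_neg // !mul0r.
  rewrite normcM [leRHS]normcM ler_wpM2l ?normc_ge0 // !normcXz -!exprnP.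
  by rewrite lerXn2r ?nnegrE ?normc_ge0 ?normc_scale_q.
have hs n : has_sum (fun m => coef q a Q m * xn n ^ m) (psi a Q (xn n)).
  apply: abs_summable_has_sum; apply: (abs_summable_le (C := 1) summ) => m.
  by rewrite mul1r.
(* The functional equation (1 - y) f(y) = (1 - a y) f(q y); iterating it moves the
   argument to 0, where only the term of index 0 survives. *)
have fe n : (1 - xn n) * psi a Q (xn n) = (1 - a * xn n) * psi a Q (xn n.+1).
  have h1 := has_sumZ (xn n) (has_sumB (hs n) (has_sumZ a (hs n.+1))).
  have h2 := has_sum_succ (has_sumB (hs n) (hs n.+1)).
  have e : xn n * (psi a Q (xn n) - a * psi a Q (xn n.+1)) =
           psi a Q (xn n) - psi a Q (xn n.+1).
    apply: has_sum_unique h1 _; apply: has_sum_ext h2 => m /=.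
    have := coef_rec q_gt0 q_lt1 m ha hq.
    rewrite !xnSz !expfzDr // qzD // qz1 expr1z.
    move: (xn n) (coef q a Q m) (coef q a Q (m + 1)) (qz q m) (xn n ^ m) => y A1 A2 z w h.
    transitivity (A2 * (1 - Q * z) * w * y); first by ring.
    by rewrite -h; ring.
  move: (xn n) (psi a Q (xn n)) (psi a Q (xn n.+1)) e => y h h' e.
  apply/eqP; rewrite -subr_eq0; apply/eqP.
  transitivity (h - h' - y * (h - a * h')); first by ring.
  by rewrite e subrr.
have step n : qpoch_fin x q n * psi a Q x = qpoch_fin (a * x) q n * psi a Q (xn n).
  elim: n => [|n IH].
    have xn_0 : xn 0 = x by rewrite /xn expr0 mulr1.
    by rewrite !qpoch_fin0 xn_0.
  rewrite !qpoch_finS mulrAC IH -[RHS]mulrA -[a * x * _]mulrA -/(xn n) -fe.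
  by rewrite -/(xn n); ring.
have lim : (psi a Q (xn n) @[n --> \oo] --> (1 : R[i]))%classic.
  pose f (m : int) : R[i] := if m == 0 then 1 else 0.
  have -> : 1 = series_sum f.
    by apply/esym/(has_sumE (has_sum_delta _)) => n; rewrite /f => /negPf ->.
  apply: (series_sum_dominated summ dom) => -[[|m]|m].
  - rewrite /f /=; under eq_fun do rewrite coef0 expr0z mulr1; exact: cvg_cst.
  - rewrite /f /=; have qm0 : 0 < q ^+ m.+1 by rewrite exprn_gt0.
    have qm1 : q ^+ m.+1 < 1 by rewrite exprn_ilt1 // ltW.
    have := cvg_qX_scale qm0 qm1 (coef q a Q m.+1 * x ^+ m.+1).
    have -> // : (fun n => coef q a Q m.+1 * xn n ^ m.+1) =
      (fun n => coef q a Q m.+1 * x ^+ m.+1 * ((q ^+ m.+1) ^+ n)%:C).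
    apply/funext => n; rewrite -exprnP exprMn -rmorphXn mulrA.
    by rewrite -!exprM mulnC.
  - rewrite /f /=; under eq_fun do rewrite coef_q_neg // mul0r; exact: cvg_cst.
have l1 : (qpoch_fin x q n * psi a Q x @[n --> \oo] --> P x * psi a Q x)%classic.
  exact: (cvgM (qpoch_inf_cvg x q_gt0 q_lt1) (cvg_cst (psi a Q x))).
have l2 := cvgM (qpoch_inf_cvg (a * x) q_gt0 q_lt1) lim.
rewrite mulr1 in l2; rewrite mulrC.
have l3 : (qpoch_fin x q n * psi a Q x @[n --> \oo] --> P (a * x))%classic.
  by rewrite (funext step); exact: l2.
exact: (cvg_unique _ l1 l3).
Qed.

Definition ramanujan_at a b x : Prop :=
  psi a b x * (P b * P (Q / a) * P x * P (b / (a * x))) =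
  P Q * P (b / a) * P (a * x) * P (Q / (a * x)).

(** For [b = q ^ k] the index shift [n -> n + 1], which replaces [(a, b)] by
[(a q, b q)], reduces the sum to the q-binomial theorem. *)
Lemma ramanujan_qX (k : nat) a x : num_regular q a -> a != 0 ->
  normc ((q ^+ k.+1)%:C / a) < normc x -> normc x < 1 ->
  ramanujan_at a (q ^+ k.+1)%:C x.
Proof.
elim: k a => [|k IH] a ha a0 bx x1.
  rewrite /ramanujan_at expr1 in bx *; have := q_binomial ha a0 bx x1 => h.
  transitivity (psi a Q x * P x * (P Q * P (Q / a) * P (Q / (a * x)))); first by ring.
  by rewrite h; ring.
have Q0 : Q != 0 by exact: qC_neq0.
have x0 : x != 0 by rewrite -normc_gt0 (le_lt_trans (normc_ge0 _) bx).
pose a' := a / Q; pose b' : R[i] := (q ^+ k.+1)%:C.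
have aE : a = a' * Q by rewrite /a' divfK.
have bE : (q ^+ k.+2)%:C = b' * Q by rewrite exprSr rmorphM.
have a'0 : a' != 0 by rewrite mulf_neq0 ?invr_eq0.
have ha1 : num_regular q (a' * Q) by rewrite -aE.
have ha' := num_regular_unshift ha1.
have hb' : den_regular q b' by exact: den_regular_qX.
have hb : den_regular q (b' * Q) by exact: den_regular_shift.
have bx' : normc (b' / a') < normc x.
  by move: bx; rewrite bE aE -mulf_div divff // mulr1.
have a1 : 1 - a' != 0.
  have := num_regularP q_gt0 (n := -1) ha1; rewrite -mulrA -qz1 -qzD // addrN qz0 mulr1.
  exact.
have bx2 : normc (b' * Q / a) < normc x by rewrite -bE.
have shift : (1 - a') * x * psi a (b' * Q) x = (1 - b') * psi a' b' x.
  have h1 := has_sumZ ((1 - a') * x) (psi_has_sum ha hb a0 bx2 x1).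
  have h2 := has_sumZ (1 - b') (has_sum_succ (psi_has_sum ha' hb' a'0 bx' x1)).
  apply: has_sum_unique h1 _; apply: has_sum_ext h2 => n.
  rewrite mulrA (mulrC (1 - b')) coef_shift // -aE expfzDr // expr1z.
  by rewrite /=; ring.
have := IH _ ha' a'0 bx' x1; rewrite /ramanujan_at -/b' bE => ih.
apply: (mulfI (mulf_neq0 a1 x0)).
have e1 : b' * Q / a = b' / a' by rewrite aE; field; rewrite a'0 Q0.
have e2 : b' * Q / (a * x) = b' / (a' * x) by rewrite aE; field; rewrite x0 a'0 Q0.
have e3 : P b' = (1 - b') * P (b' * Q) by exact: qpoch_infS.
have e4 : P (Q / a) = (1 - a'^-1) * P (Q / a').
  have -> : Q / a = a'^-1 by rewrite aE; field; rewrite a'0 Q0.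
  by rewrite (qpoch_infS _ q_gt0 q_lt1) (mulrC _ Q).
have e5 : P (a' * x) = (1 - a' * x) * P (a * x).
  have -> : a * x = a' * x * Q by rewrite aE mulrAC.
  exact: qpoch_infS.
have e6 : P (Q / (a * x)) = (1 - (a' * x)^-1) * P (Q / (a' * x)).
  have -> : Q / (a * x) = (a' * x)^-1 by rewrite aE; field; rewrite x0 a'0 Q0.
  by rewrite (qpoch_infS _ q_gt0 q_lt1) (mulrC _ Q).
transitivity ((1 - a'^-1) *
  (psi a' b' x * (P b' * P (Q / a') * P x * P (b' / (a' * x))))).
  rewrite e2 e3 e4 [LHS]mulrA shift; ring.
rewrite ih e1 e5 e6; field.
by rewrite x0 a'0.
Qed.

(** Ramanujan's 1psi1 summation formula. The factor independent of [b] in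
[psi_den_factor] is found by taking for [b] a power of [q] that is small enough
for the series to converge at [x]. *)
Lemma ramanujan a b x : num_regular q a -> den_regular q b -> a != 0 ->
  normc (b / a) < normc x -> normc x < 1 -> ramanujan_at a b x.
Proof.
move=> ha hb a0 bx x1.
have x0 : 0 < normc x := le_lt_trans (normc_ge0 _) bx.
have na0 : 0 < normc a by rewrite normc_gt0.
have [k hk] : exists k : nat, normc ((q ^+ k.+1)%:C / a) < normc x.
  have d0 : 0 < normc x * normc a by rewrite mulr_gt0.
  have /cvgrPdist_lt/(_ _ d0) [N _ /(_ N.+1 (leqnSn N))] := cvg_geo q_gt0 q_lt1.
  rewrite sub0r normrN ger0_norm ?exprn_ge0 ?(ltW q_gt0) // => h.
  exists N; rewrite normcM normcV normc_nneg ?exprn_ge0 ?(ltW q_gt0) //.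
  by rewrite ltr_pdivrMr.
have hM := @den_regular_qX R q q_gt0 q_lt1 k.+1 isT.
have := ramanujan_qX ha a0 hk x1; have := psi_den_factor ha hM a0 hk x1.
have := psi_den_factor ha hb a0 bx x1; rewrite /ramanujan_at.
have : P ((q ^+ k.+1)%:C / a) != 0.
  by apply: qpoch_inf_neq0_small => //; exact: lt_trans hk x1.
move: (_%:C) => c c0 h1 h2 h3.
have G : psi a 0 x * (P (Q / a) * P x) = P Q * P (a * x) * P (Q / (a * x)).
  apply: (mulfI c0); rewrite [LHS]mulrA -h2.
  transitivity (psi a c x * (P c * P (Q / a) * P x * P (c / (a * x)))); first by ring.
  by rewrite h3; ring.
transitivity (psi a b x * P b * P (b / (a * x)) * (P (Q / a) * P x)); first by ring.
by rewrite h1 -[LHS]mulrA G; ring.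
Qed.

End Ramanujan.

(** * Products over roots of unity *)

Section RootsOfUnity.
Variable R : realType.

Lemma rho_cube : (rho : R[i]) ^+ 3 = 1.
Proof.
pose t : R := 2 * pi / 3; have t3 : t + t + t = pi *+ 2 by rewrite /t; field.
have e (u v : R) : (cos u +i* sin u) * (cos v +i* sin v) = cos (u + v) +i* sin (u + v).
  by rewrite cosD sinD; simpc; rewrite [X in _ +i* X]addrC.
rewrite /rho -/t !exprS expr0 mulr1 !e addrA t3.
by rewrite cos2pi sin2pi.
Qed.

Lemma rho_neq1 : (rho : R[i]) != 1.
Proof.
rewrite eq_complex negb_and; apply/orP; right; rewrite /= gt_eqF //.
by have := pi_gt0 R => p0; apply: sin_gt0_pi; lra.
Qed.

Lemma rho_sum : 1 + rho + rho ^+ 2 = 0 :> R[i].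
Proof.
have : ((rho : R[i]) - 1) * (1 + rho + rho ^+ 2) = 0.
  by transitivity ((rho : R[i]) ^+ 3 - 1); [ring | rewrite rho_cube subrr].
by move/eqP; rewrite mulf_eq0 subr_eq0 (negPf rho_neq1) => /eqP.
Qed.

Lemma normc_unity_root (n : nat) (z : R[i]) : (0 < n)%N -> z ^+ n = 1 -> normc z = 1.
Proof.
move=> n0 /(congr1 (@normc R)); rewrite normcX normc1 => /eqP.
by rewrite pexpr_eq1 ?normc_ge0 // => /eqP.
Qed.

Lemma normc_rho : normc (rho : R[i]) = 1.
Proof. exact: normc_unity_root rho_cube. Qed.

Lemma rho_neq0 : (rho : R[i]) != 0.
Proof. by rewrite -normc_gt0 normc_rho. Qed.

Lemma rho_factorization (t : R[i]) :
  (1 - t) * (1 - rho * t) * (1 - rho ^+ 2 * t) = 1 - t ^+ 3.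
Proof.
apply/eqP; rewrite -subr_eq0; apply/eqP.
transitivity ((1 - rho ^+ 3) * t ^+ 3 - (1 + rho + rho ^+ 2) * (t - rho * t ^+ 2)).
  by ring.
by rewrite rho_sum rho_cube subrr !mul0r subrr.
Qed.

End RootsOfUnity.

Section RootProducts.
Variable R : realType.
Variables (q : R) (p : nat) (ws : seq R[i]).
Hypotheses (q_gt0 : 0 < q) (q_lt1 : q < 1) (p_gt0 : (0 < p)%N).
Hypothesis size_ws : size ws = p.
Hypothesis ws_factor : forall t, \prod_(w <- ws) (1 - w * t) = 1 - t ^+ p.
Hypothesis ws_factorV : forall t, \prod_(w <- ws) (1 - w^-1 * t) = 1 - t ^+ p.
Hypothesis ws_norm : forall w, w \in ws -> normc w = 1.

Local Notation P c := (qpoch_inf c q).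
Local Notation Pp c := (qpoch_inf c (q ^+ p)).
Local Notation Q := (q%:C : R[i]).

Lemma prod_const_roots (c : R[i]) : \prod_(w <- ws) c = c ^+ p.
Proof. by rewrite big_const_seq count_predT size_ws iter_mulr_1. Qed.

Lemma prod_roots_split (c : R[i]) (G H : R[i] -> R[i]) :
  \prod_(w <- ws) (c * G w * H w) = c ^+ p * \prod_(w <- ws) G w * \prod_(w <- ws) H w.
Proof. by rewrite !big_split /= prod_const_roots. Qed.

Lemma qpoch_inf_rootsV (c : R[i]) : \prod_(w <- ws) P (c / w) = Pp (c ^+ p).
Proof.
rewrite (@qpoch_inf_roots _ c q p (map GRing.inv ws)) //; last by move=> t; rewrite big_map.
by rewrite big_map; apply: eq_bigr => w _; rewrite mulrC.
Qed.

(** Apply Ramanujan's formula to every factor, and to the sum in base [q ^ p]: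
the theta quotients in [y] agree, since [\prod_w (w c; q) = (c ^ p; q ^ p)]. *)
Lemma psi_roots (a b y : R[i]) :
  num_regular q a -> den_regular q b -> a != 0 ->
  num_regular (q ^+ p) (a ^+ p) -> den_regular (q ^+ p) (b ^+ p) ->
  normc (b / a) < normc y -> normc y < 1 ->
  (\prod_(w <- ws) psi q a b (w * y)) *
    ((P b * P (Q / a)) ^+ p * (Pp ((q ^+ p)%:C) * Pp (b ^+ p / a ^+ p))) =
  (P Q * P (b / a)) ^+ p * (Pp (b ^+ p) * Pp ((q ^+ p)%:C / a ^+ p)) *
    psi (q ^+ p) (a ^+ p) (b ^+ p) (y ^+ p).
Proof.
move=> ha hb a0 hap hbp bay y1.
have qp0 : 0 < q ^+ p by rewrite exprn_gt0.
have qp1 : q ^+ p < 1 by rewrite exprn_ilt1 ?(ltW q_gt0) // -lt0n.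
have y0 : 0 < normc y := le_lt_trans (normc_ge0 _) bay.
have yn0 : y != 0 by rewrite -normc_gt0.
have bayp : normc (b ^+ p / a ^+ p) < normc (y ^+ p).
  by rewrite -expr_div_n !normcX ltrXn2r ?nnegrE ?normc_ge0 // -lt0n.
have yp1 : normc (y ^+ p) < 1 by rewrite normcX exprn_ilt1 ?normc_ge0 // -lt0n.
have ap0 : a ^+ p != 0 by rewrite expf_neq0.
have hp := ramanujan qp0 qp1 hap hbp ap0 bayp yp1.
have n1 : Pp (y ^+ p) != 0 by exact: qpoch_inf_neq0_small.
have n2 : Pp (b ^+ p / (a ^+ p * y ^+ p)) != 0.
  apply: qpoch_inf_neq0_small => //; rewrite invfM mulrA normcM normcV.
  by rewrite ltr_pdivrMr ?mul1r // normcX exprn_gt0.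
have hw : \prod_(w <- ws) (psi q a b (w * y) *
    (P b * P (Q / a) * P (w * y) * P (b / (a * y) / w))) =
    \prod_(w <- ws) (P Q * P (b / a) * P (w * (a * y)) * P (Q / (a * y) / w)).
  apply: eq_big_seq => w /ws_norm nw.
  have w0 : w != 0 by rewrite -normc_gt0 nw.
  have e c : c / (a * y) / w = c / (a * (w * y)) by field; rewrite a0 w0 yn0.
  rewrite !e (mulrCA w a); apply: ramanujan => //.
    by rewrite (normcM w) nw mul1r.
  by rewrite (normcM w) nw mul1r.
rewrite big_split /= in hw.
rewrite (prod_roots_split _ (fun w => P (w * y)) (fun w => P (b / (a * y) / w))) in hw.
rewrite (prod_roots_split _ (fun w => P (w * (a * y))) (fun w => P (Q / (a * y) / w))) in hw.
rewrite (qpoch_inf_rootsV (b / (a * y))) (qpoch_inf_rootsV (Q / (a * y))) in hw.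
rewrite -(@qpoch_inf_roots _ y q p ws q_gt0 q_lt1 p_gt0 ws_factor) in hw.
rewrite -(@qpoch_inf_roots _ (a * y) q p ws q_gt0 q_lt1 p_gt0 ws_factor) in hw.
rewrite /ramanujan_at in hp.
have ee c : (c / (a * y)) ^+ p = c ^+ p / (a ^+ p * y ^+ p) by rewrite expr_div_n exprMn.
rewrite !ee -rmorphXn [(a * y) ^+ p]exprMn in hw.
apply: (mulIf (mulf_neq0 n1 n2)).
move: hw hp; set X := \prod_(w <- ws) _; set Y := psi _ _ _ _ => hw hp.
set T := Pp (y ^+ p) in hw hp *; set U := Pp (b ^+ p / (a ^+ p * y ^+ p)) in hw hp *.
transitivity (X * ((P b * P (Q / a)) ^+ p * T * U) *
  (Pp ((q ^+ p)%:C) * Pp (b ^+ p / a ^+ p))); first by ring.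
transitivity ((P Q * P (b / a)) ^+ p *
  (Y * (Pp (b ^+ p) * Pp ((q ^+ p)%:C / a ^+ p) * T * U))); last by ring.
by rewrite hw hp; ring.
Qed.

End RootProducts.

(** * Gaussian weights and twisted products of series *)

Section GaussianWeights.
Variable R : realType.
Variables (q alpha : R).
Hypotheses (q_gt0 : 0 < q) (q_lt1 : q < 1) (alpha_ge0 : 0 <= alpha).

Let s : R := q `^ alpha.
Let s_gt0 : 0 < s. Proof. exact: powR_gt0. Qed.
Let s_neq0 : s != 0. Proof. by rewrite gt_eqF. Qed.

Lemma powR_square (N : int) : q `^ (alpha * (N ^+ 2)%:~R) = s ^ (N ^+ 2).
Proof. by rewrite powRrM powR_intmul // ltW. Qed.

Lemma powR_linear (N : int) : q `^ (2 * alpha * N%:~R) = s ^ (2 * N).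
Proof.
have -> : 2 * alpha * N%:~R = alpha * (2 * N)%:~R by rewrite intrM; ring.
by rewrite powRrM powR_intmul // ltW.
Qed.

(** The weight [q ^ (alpha N ^ 2) x ^ N] of total index [N], normalized by the
radius [r] on which the bilateral series are evaluated. *)
Definition gauss (x : R[i]) (r : R) (N : int) : R[i] :=
  (q `^ (alpha * (N ^+ 2)%:~R))%:C * (x / r%:C) ^ N.

(** For [alpha > 0] the Gaussian factor wins over any geometric growth; for
[alpha = 0] boundedness forces [r] to be the modulus of [x]. *)
Lemma gauss_bounded (x : R[i]) (r : R) : 0 < r -> x != 0 -> (alpha = 0 -> normc x = r) ->
  exists B, forall N, normc (gauss x r N) <= B.
Proof.
move=> r0 x0 a0; pose t := normc (x / r%:C).
have t0 : 0 < t by rewrite normc_gt0 mulf_neq0 // invr_eq0 -normc_gt0 normc_nneg // ltW.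
have [az|an] := eqVneq alpha 0.
  have t1 : t = 1.
    by rewrite /t normcM normcV normc_nneg ?(ltW r0) // a0 // divff // gt_eqF.
  exists 1 => N; rewrite /gauss az mul0r powRr0 mul1r normcXz -/t t1.
  by rewrite exp1rz.
have s1 : s < 1.
  have : q `^ alpha < 1 `^ alpha.
    have al : 0 < alpha by rewrite lt_def an.
    by apply: (gt0_ltr_powR al) => //; rewrite nnegrE ?ler01 ?(ltW q_gt0).
  by rewrite powR1.
pose y := Num.max t t^-1; have y0 : 0 < y by rewrite lt_max t0.
have [B HB] : exists B : R, forall n : nat, (s ^+ n ^+ n) * y ^+ n <= B * 1 ^+ n.
  apply: (@ratio_bound R (fun n => (s ^+ n ^+ n) * y ^+ n) (fun=> 1)
    (fun n => s * y * (s ^+ 2) ^+ n) 1 0 1) => //.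
  - by move=> n; rewrite mulr_ge0 ?exprn_ge0 // ltW.
  - by move=> n; rewrite !mulr_ge0 ?exprn_ge0 // ltW.
  - exact: cvg_cst.
  - have h : ((s ^+ 2) ^+ n @[n --> \oo] --> (0 : R))%classic.
      by apply: cvg_geo; rewrite ?exprn_gt0 // exprn_ilt1 // ltW.
    have h2 := cvgM (cvg_cst (s * y)) h; rewrite mulr0 in h2; exact: h2.
  - move=> n; rewrite mul1r le_eqVlt; apply/orP; left; apply/eqP.
    rewrite -!exprM (_ : n.+1 * n.+1 = n * n + 2 * n + 1)%N; last by ring.
    by rewrite !exprD expr1 exprS; ring.
exists B => N; apply: le_trans (_ : s ^+ `|N|%N ^+ `|N|%N * y ^+ `|N|%N <= _); last first.
  by have := HB `|N|%N; rewrite expr1n mulr1.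
rewrite /gauss powR_square normcM normcXz -/t normc_nneg; last first.
  by rewrite exprz_ge0 // ltW.
have -> : s ^ (N ^+ 2) = s ^+ `|N|%N ^+ `|N|%N.
  have -> : N ^+ 2 = (`|N| * `|N|)%N%:Z by rewrite PoszM -expr2 abszE real_normK ?num_real.
  by rewrite -exprnP exprM.
rewrite ler_wpM2l ?exprn_ge0 ?(ltW s_gt0) //.
case: N => n; rewrite ?NegzE -?exprnN -?exprnP ?abszN /= -?exprVn.
  by rewrite lerXn2r ?nnegrE ?(ltW t0) ?(ltW y0) // le_max lexx.
by rewrite lerXn2r ?nnegrE ?invr_ge0 ?(ltW t0) ?(ltW y0) // le_max lexx orbT.
Qed.

(** Completing the square: [N ^ 2 + n ^ 2 + 2 N n = (N + n) ^ 2]. *)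
Lemma B_term_shift (a b w x : R[i]) (r : R) (N n : int) :
  0 < r -> x != 0 -> w != 0 ->
  (q `^ (alpha * (N ^+ 2)%:~R))%:C * x ^ N *
    B_term q alpha a b (w * x * (q `^ (2 * alpha * N%:~R))%:C) n =
  r%:C ^ N * (coef q a b n * (w * r%:C) ^ n * gauss x r (N + n)).
Proof.
move=> r0 x0 w0; rewrite /B_term /gauss /coef !powR_square powR_linear.
have rc0 : r%:C != 0 :> R[i] by rewrite -normc_gt0 normc_nneg // ltW.
have sc0 (k : int) : (s ^ k)%:C != 0 :> R[i].
  by rewrite -normc_gt0 normc_nneg ?exprz_gt0 // ltW // exprz_gt0.
have sM (k l : int) : (s ^ (k * l))%:C = (s ^ k)%:C ^ l :> R[i].
  by rewrite -exprz_exp rmorphXz ?unitfE ?expfz_neq0.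
have -> : (s ^ ((N + n) ^+ 2))%:C =
    (s ^ (N ^+ 2))%:C * (s ^ (n ^+ 2))%:C * (s ^ (2 * N))%:C ^ n :> R[i].
  rewrite -sM -!rmorphM -!expfzDr //; congr ((_ ^ _)%:C); ring.
rewrite !exprzMl ?unitfE ?mulf_neq0 ?invr_eq0 // !expfzDr ?mulf_neq0 ?invr_eq0 //.
have rV (k : int) : (r%:C : R[i])^-1 ^ k = (r%:C ^ k)^-1 by rewrite exprz_inv invr_expz.
rewrite !rV.
move: (expfz_neq0 N rc0) (expfz_neq0 n rc0); move: (r%:C ^ N) (r%:C ^ n) => y1 y2 y10 y20.
move: (x ^ N) (x ^ n) (w ^ n) (qpoch a q n) (qpoch b q n)^-1 => x1 x2 w1 A V.
move: ((s ^ (2 * N))%:C ^ n) (s ^ (N ^+ 2))%:C (s ^ (n ^+ 2))%:C => s3 s1 s2.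
by field; rewrite y10 y20.
Qed.

End GaussianWeights.

Section WeightedIdentity.
Variable R : realType.
Variables (q r : R) (a b : R[i]) (p : nat).
Hypotheses (q_gt0 : 0 < q) (q_lt1 : q < 1) (p_gt0 : (0 < p)%N).
Hypotheses (a_num : num_regular q a) (b_den : den_regular q b) (a_neq0 : a != 0).
Hypotheses (ap_num : num_regular (q ^+ p) (a ^+ p)) (bp_den : den_regular (q ^+ p) (b ^+ p)).
Hypotheses (lt_ba_r : normc (b / a) < r) (r_lt1 : r < 1).

Let r_gt0 : 0 < r. Proof. exact: le_lt_trans (normc_ge0 _) lt_ba_r. Qed.
Let rc_neq0 : r%:C != 0 :> R[i].
Proof. by rewrite -normc_gt0 normc_nneg // ltW. Qed.

Lemma coef_circle_summable (w : R[i]) : normc w = 1 ->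
  abs_summable (fun n : int => coef q a b n * (w * r%:C) ^ n).
Proof.
move=> w1; have nw : normc (w * r%:C) = r.
  by rewrite normcM w1 mul1r normc_nneg // ltW.
by apply: coef_summable; rewrite ?nw.
Qed.

Lemma coef_pow_summable :
  abs_summable (fun m : int => coef (q ^+ p) (a ^+ p) (b ^+ p) m * (r%:C ^+ p) ^ m).
Proof.
have r0 := ltW r_gt0; apply: coef_summable => //.
- by rewrite exprn_gt0.
- by rewrite exprn_ilt1 ?(ltW q_gt0) // -lt0n.
- by rewrite expf_neq0.
- rewrite -expr_div_n !normcX normc_nneg //.
  by rewrite ltrXn2r ?nnegrE ?normc_ge0 // -lt0n.
- by rewrite normcX normc_nneg // exprn_ilt1 // -lt0n.
Qed.

(** A factorization of the series on the circle of radius [r] gives an identity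
between the same series twisted by any bounded weight of the total index. *)
Lemma weighted_identity (I : choiceType) (u : I -> R[i]) (g : I -> int) (w C : R[i])
    (e : int -> R[i]) (B : R) :
  abs_summable u -> normc w = 1 -> (forall n, normc (e n) <= B) ->
  (forall (P : nat) (z : R[i]), (0 < P)%N -> z ^+ P = 1 ->
     series_sum (fun i => u i * z ^ g i) * psi q a b (w * (r%:C * z)) =
     C * psi (q ^+ p) (a ^+ p) (b ^+ p) ((r%:C * z) ^+ p)) ->
  let S i := u i * series_sum (fun n : int =>
    coef q a b n * (w * r%:C) ^ n * e (g i + n)) in
  [/\ forall N : int, abs_summable (fun n : int => coef q a b n * (w * r%:C) ^ n * e (N + n)),
      abs_summable (fun m : int =>
        coef (q ^+ p) (a ^+ p) (b ^+ p) m * (r%:C ^+ p) ^ m * e (p%:Z * m)),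
      abs_summable S &
      series_sum S = C * series_sum (fun m : int =>
        coef (q ^+ p) (a ^+ p) (b ^+ p) m * (r%:C ^+ p) ^ m * e (p%:Z * m))].
Proof.
move=> au w1 eB H S.
have w0 : w != 0 by rewrite -normc_gt0 w1.
pose v (n : int) := coef q a b n * (w * r%:C) ^ n.
pose vp (m : int) := coef (q ^+ p) (a ^+ p) (b ^+ p) m * (r%:C ^+ p) ^ m.
have av : abs_summable v by exact: coef_circle_summable.
have avp : abs_summable vp by exact: coef_pow_summable.
have weigh (T : choiceType) (f : T -> R[i]) (h : T -> int) :
    abs_summable f -> abs_summable (fun t => f t * e (h t)).
  move/(abs_summable_le (C := B)); apply => t.
  by rewrite normcM mulrC ler_wpM2r ?normc_ge0.
(* After twisting by a root of unity the double series is a product of two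
   simple ones, which the hypothesis evaluates. *)
have [aF _] := series_sum_prod au av.
have T : series_sum (fun t : I * int => (u t.1 * v t.2) * e (g t.1 + t.2)) =
    series_sum (fun m : int => (C * vp m) * e (p%:Z * m)).
  apply: (@series_sum_twist R (I * int)%type int _ (fun t => g t.1 + t.2) _
    (fun m => p%:Z * m) aF (abs_summableZ C avp) _ e B eB) => P z P0 zP.
  have z0 := unity_root_neq0 P0 zP; have nz := normc_unity_root P0 zP.
  have tw (T : choiceType) (f : T -> R[i]) (h : T -> int) :
      abs_summable f -> abs_summable (fun t => f t * z ^ h t).
    move/(abs_summable_le (C := 1)); apply => t.
    by rewrite normcM normcXz nz exp1rz mulr1 mul1r.
  have [_ e1] := series_sum_prod (tw _ _ g au) (tw _ _ id av).
  have -> : (fun t : I * int => u t.1 * v t.2 * z ^ (g t.1 + t.2)) =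
      (fun t : I * int => u t.1 * z ^ g t.1 * (v t.2 * z ^ t.2)).
    by apply/funext => t; rewrite expfzDr // mulrACA.
  rewrite e1.
  have -> : (fun n : int => v n * z ^ n) =
      (fun n : int => coef q a b n * (w * (r%:C * z)) ^ n).
    by apply/funext => n; rewrite /v -mulrA -exprzMl ?unitfE ?mulf_neq0 // !mulrA.
  have := H P z P0 zP; rewrite [psi q a b _]/psi => ->.
  rewrite /psi; apply/esym/has_sumE.
  have -> : (fun m : int => C * vp m * z ^ (p%:Z * m)) =
      (fun m : int => C * (vp m * z ^ (p%:Z * m))).
    by apply/funext => m; rewrite mulrA.
  have -> : (fun m : int => coef (q ^+ p) (a ^+ p) (b ^+ p) m * ((r%:C * z) ^+ p) ^ m) =
      (fun m : int => vp m * z ^ (p%:Z * m)).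
    apply/funext => m; rewrite /vp -mulrA; congr (_ * _).
    by rewrite exprMn exprzMl ?unitfE ?expf_neq0 // -exprz_exp -exprnP.
  apply: has_sumZ; apply: abs_summable_has_sum; exact: tw.
have [F1 F2 F3] := series_sum_fubini (weigh _ _ (fun t => g t.1 + t.2) aF).
have SE : (fun i => series_sum (fun n : int => u i * v n * e (g i + n))) = S.
  apply/funext => i; apply: has_sumE.
  apply: has_sum_ext (has_sumZ (u i) (abs_summable_has_sum (weigh _ _ (fun n => g i + n) av))) => n.
  by rewrite mulrA.
rewrite /= SE in F2 F3; split => //.
- by move=> N; exact: weigh.
- exact: weigh.
rewrite F3 T; apply: has_sumE.
apply: has_sum_ext (has_sumZ C (abs_summable_has_sum (weigh _ _ ( *%R p%:Z) avp))) => m.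
by rewrite mulrA.
Qed.

End WeightedIdentity.

(** * The two identities *)

Section Assembly.
Variable R : realType.

Lemma B_shift_sum (q alpha r : R) (a b w x : R[i]) (N : int) :
  0 < q -> 0 < r -> x != 0 -> w != 0 ->
  abs_summable (fun n : int => coef q a b n * (w * r%:C) ^ n * gauss q alpha x r (N + n)) ->
  abs_summable (B_term q alpha a b (w * x * (q `^ (2 * alpha * N%:~R))%:C)) /\
  (q `^ (alpha * (N ^+ 2)%:~R))%:C * x ^ N *
    B q alpha a b (w * x * (q `^ (2 * alpha * N%:~R))%:C) =
  r%:C ^ N * series_sum (fun n : int =>
    coef q a b n * (w * r%:C) ^ n * gauss q alpha x r (N + n)).
Proof.
move=> q0 r0 x0 w0; set h := fun n : int => _ => ah.
set c := _ * x ^ N; set T := B_term _ _ _ _ _.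
have c0 : c != 0.
  by rewrite mulf_neq0 ?expfz_neq0 // -normc_gt0 normc_nneg ?powR_gt0 // powR_ge0.
have TE n : c * T n = r%:C ^ N * h n by exact: B_term_shift.
have aT : abs_summable T.
  have -> : T = (fun n => (c^-1 * r%:C ^ N) * h n).
    by apply/funext => n; rewrite -mulrA -TE mulKf.
  exact: abs_summableZ.
split=> //; apply: has_sum_unique (has_sumZ c (abs_summable_has_sum aT)) _.
apply: has_sum_ext (has_sumZ (r%:C ^ N) (abs_summable_has_sum ah)) => n.
by rewrite TE.
Qed.

Lemma B_term_pow (q alpha r : R) (a b x : R[i]) (p : nat) (m : int) :
  0 < q -> 0 < r -> x != 0 ->
  B_term (q ^+ p) (p%:R * alpha) (a ^+ p) (b ^+ p) (x ^+ p) m =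
  coef (q ^+ p) (a ^+ p) (b ^+ p) m * (r%:C ^+ p) ^ m * gauss q alpha x r (p%:Z * m).
Proof.
move=> q0 r0 x0; rewrite /B_term /gauss -/(coef _ _ _ _).
have rc0 : r%:C != 0 :> R[i] by rewrite -normc_gt0 normc_nneg // ltW.
have -> : (q ^+ p) `^ (p%:R * alpha * (m ^+ 2)%:~R) = q `^ (alpha * ((p%:Z * m) ^+ 2)%:~R).
  rewrite -powR_mulrn ?(ltW q0) // -powRrM; congr (q `^ _).
  have pR : p%:Z%:~R = p%:R :> R by [].
  by rewrite !expr2 !intrM pR; ring.
have -> : (x / r%:C) ^ (p%:Z * m) = (x ^+ p) ^ m / (r%:C ^+ p) ^ m.
  rewrite -exprz_exp -exprnP expr_div_n exprzMl ?unitfE ?invr_eq0 ?expf_neq0 //.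
  by rewrite exprz_inv invr_expz.
have := expfz_neq0 m (expf_neq0 p rc0).
move: (coef _ _ _ _) (_%:C) ((x ^+ p) ^ m) ((r%:C ^+ p) ^ m) => A W X Y Y0.
by field.
Qed.

Lemma qpoch_inf_den_neq0 (q : R) (b : R[i]) : 0 < q -> q < 1 -> den_regular q b ->
  qpoch_inf b q != 0.
Proof.
move=> q0 q1 hb; apply: qpoch_inf_neq0 => // j; rewrite eq_sym -subr_eq0.
exact: (den_regularP q0 hb (n := j)).
Qed.

Lemma qpoch_inf_num_neq0 (q : R) (a : R[i]) : 0 < q -> q < 1 -> a != 0 ->
  num_regular q a -> qpoch_inf (q%:C / a) q != 0.
Proof.
move=> q0 q1 a0 ha; apply: qpoch_inf_neq0 => // j.
apply: contra (ha j.+1 isT) => /eqP h.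
by rewrite -[a]mulr1 -h exprS rmorphM mulrA (mulrC a) divfK.
Qed.

Lemma num_regular_pow (q : R) (a : R[i]) (p : nat) :
  (forall k : nat, (1 <= k)%N -> a ^+ p != (q ^+ (p * k))%:C) -> num_regular (q ^+ p) (a ^+ p).
Proof. by move=> h k /h; rewrite exprM. Qed.

Lemma den_regular_pow (q : R) (b : R[i]) (p : nat) :
  (forall k : nat, b ^+ p != (q ^- (p * k))%:C) -> den_regular (q ^+ p) (b ^+ p).
Proof. by move=> h k; have := h k; rewrite exprM. Qed.

(** For [alpha = 0] only the circle through [x] will do; otherwise the
radius may lie anywhere between [|b / a|] and 1. *)
Lemma radius_exists (alpha : R) (a b x : R[i]) : normc b < normc a -> a != 0 ->
  (alpha = 0 -> normc (b / a) < normc x /\ normc x < 1) ->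
  exists r : R, [/\ normc (b / a) < r, r < 1 & alpha = 0 -> normc x = r].
Proof.
move=> ba a0 ann; have [/ann[h1 h2]|h] := eqVneq alpha 0.
  by exists (normc x).
have ba1 : normc (b / a) < 1.
  by rewrite normcM normcV ltr_pdivrMr ?normc_gt0 // mul1r.
exists ((normc (b / a) + 1) / 2); split; [lra | lra |].
by move=> a00; rewrite a00 eqxx in h.
Qed.

End Assembly.

Section Identities.
Variable R : realType.
Variables (q alpha : R) (a b x : R[i]).
Hypotheses (q_gt0 : 0 < q) (q_lt1 : q < 1) (alpha_ge0 : 0 <= alpha).
Hypotheses (a_neq0 : a != 0) (x_neq0 : x != 0) (lt_ba : normc b < normc a).
Hypothesis annulus : alpha = 0 -> normc (b / a) < normc x /\ normc x < 1.
Hypotheses (a_num : num_regular q a) (b_den : den_regular q b).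

Local Notation P c := (qpoch_inf c q).
Local Notation Q := (q%:C : R[i]).

Let PQ_neq0 : P Q != 0.
Proof. by apply: qpoch_inf_neq0_small; rewrite // normc_nneg // ltW. Qed.

Let Pba_neq0 : P (b / a) != 0.
Proof.
apply: qpoch_inf_neq0_small => //.
by rewrite normcM normcV ltr_pdivrMr ?normc_gt0 // mul1r.
Qed.

(** The weighted series is the product of the series at [- r] and at [r], so the
relevant roots of unity are [-1] and [1]. *)
Lemma B_square_identity :
  num_regular (q ^+ 2) (a ^+ 2) -> den_regular (q ^+ 2) (b ^+ 2) ->
  let S := fun j : int =>
     qpoch a q j * (q `^ (alpha * (j ^+ 2)%:~R))%:C * (- x) ^ j / qpoch b q j
     * B q alpha a b (x * (q `^ (2 * alpha * j%:~R))%:C) in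
  [/\ series_cvg (B_term (q ^+ 2) (2 * alpha) (a ^+ 2) (b ^+ 2) (x ^+ 2)),
      forall j : int,
        series_cvg (B_term q alpha a b (x * (q `^ (2 * alpha * j%:~R))%:C)),
      series_cvg S &
      qpochs_inf [:: - b; - (q%:C / a); q%:C; b / a] q
      / qpochs_inf [:: - q%:C; - (b / a); b; q%:C / a] q
      * B (q ^+ 2) (2 * alpha) (a ^+ 2) (b ^+ 2) (x ^+ 2)
      = series_sum S].
Proof.
move=> ha2 hb2 S; have [r [bar r1 ar]] := radius_exists lt_ba a_neq0 annulus.
have r0 : 0 < r := le_lt_trans (normc_ge0 _) bar.
have [M HM] := gauss_bounded q_gt0 q_lt1 alpha_ge0 r0 x_neq0 ar.
pose ws : seq R[i] := [:: -1; 1].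
have prod2 (F : R[i] -> R[i]) : \prod_(w <- ws) F w = F (-1) * F 1.
  by rewrite !big_cons big_nil mulr1.
have wsF (t : R[i]) : \prod_(w <- ws) (1 - w * t) = 1 - t ^+ 2.
  by rewrite prod2; ring.
have wsV (t : R[i]) : \prod_(w <- ws) (1 - w^-1 * t) = 1 - t ^+ 2.
  by rewrite prod2 invrN invr1; ring.
have wsN (w : R[i]) : w \in ws -> normc w = 1.
  by rewrite !inE => /orP[] /eqP ->; rewrite ?normcNr normc1.
(* This brings the constant, which comes out in base q ^ 2, back to base q. *)
have split2 c : qpoch_inf (c ^+ 2) (q ^+ 2) = P (- c) * P c.
  by rewrite (@qpoch_inf_roots _ c q 2 ws) // prod2 mulN1r mul1r.
pose C := P (- b) * P (- (Q / a)) * P Q * P (b / a) /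
  (P (- Q) * P (- (b / a)) * P b * P (Q / a)).
pose u (j : int) := coef q a b j * (-1 * r%:C) ^ j.
have n1 : normc (-1 : R[i]) = 1 by rewrite normcNr normc1.
have au : abs_summable u by exact: coef_circle_summable.
have nQ : P (- Q) != 0.
  by apply: qpoch_inf_neq0_small; rewrite // normcNr normc_nneg // ltW.
have nba : P (- (b / a)) != 0.
  apply: qpoch_inf_neq0_small; rewrite // normcNr.
  by rewrite normcM normcV ltr_pdivrMr ?normc_gt0 // mul1r.
have nb := qpoch_inf_den_neq0 q_gt0 q_lt1 b_den.
have na := qpoch_inf_num_neq0 q_gt0 q_lt1 a_neq0 a_num.
have fact (k : nat) (z : R[i]) : (0 < k)%N -> z ^+ k = 1 ->
    series_sum (fun j => u j * z ^ j) * psi q a b (1 * (r%:C * z)) =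
    C * psi (q ^+ 2) (a ^+ 2) (b ^+ 2) ((r%:C * z) ^+ 2).
  move=> k0 zk; have nz := normc_unity_root k0 zk.
  have z0 := unity_root_neq0 k0 zk.
  have nrz : normc (r%:C * z) = r by rewrite normcM nz mulr1 normc_nneg // ltW.
  have rc0 : r%:C != 0 :> R[i] by rewrite -normc_gt0 normc_nneg // ltW.
  have -> : series_sum (fun j => u j * z ^ j) = psi q a b (-1 * (r%:C * z)).
    congr series_sum; apply/funext => j; rewrite /u mulrA -[LHS]mulrA.
    by rewrite -exprzMl // unitfE ?mulf_neq0 // oppr_eq0 oner_neq0.
  have := @psi_roots R q 2 ws q_gt0 q_lt1 isT erefl wsF wsV wsN a b (r%:C * z)
    a_num b_den a_neq0 ha2 hb2.
  rewrite nrz => /(_ bar r1); rewrite (prod2 (fun w => psi q a b (w * (r%:C * z)))).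
  move: (psi q a b (-1 * _)) (psi q a b (1 * _)) (psi (q ^+ 2) _ _ _) => X1 X2 Y.
  have e1 : b ^+ 2 / a ^+ 2 = (b / a) ^+ 2 by rewrite expr_div_n.
  have e2 : (q ^+ 2)%:C / a ^+ 2 = (Q / a) ^+ 2 by rewrite expr_div_n rmorphXn.
  have e3 : (q ^+ 2)%:C = Q ^+ 2 :> R[i] by rewrite rmorphXn.
  rewrite e1 e2 e3 (split2 (b / a)) (split2 (Q / a)) (split2 Q) (split2 b) /C.
  move: nb na nQ nba PQ_neq0 Pba_neq0.
  move: (P b) (P (Q / a)) (P Q) (P (b / a)) (P (- b)) (P (- (Q / a))) (P (- Q))
    (P (- (b / a))) => c1 c2 c3 c4 c5 c6 c7 c8 d1 d2 d7 d8 d3 d4 h.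
  have nz8 : (c1 * c2) ^+ 2 * (c7 * c3 * (c8 * c4)) != 0.
    by rewrite !mulf_neq0 ?expf_neq0 ?mulf_neq0.
  apply: (mulIf nz8); rewrite h; field.
  by rewrite d1 d2 d7 d8.
have n11 : normc (1 : R[i]) = 1 by exact: normc1.
have [V1 V2 V3 V4] := weighted_identity q_gt0 q_lt1 (isT : (0 < 2)%N) a_num b_den a_neq0
  ha2 hb2 bar r1 au n11 HM fact.
have shift (j : int) := @B_shift_sum R q alpha r a b 1 x j q_gt0 r0 x_neq0 (oner_neq0 _) (V1 j).
have BpE : B_term (q ^+ 2) (2 * alpha) (a ^+ 2) (b ^+ 2) (x ^+ 2) =
    (fun m : int => coef (q ^+ 2) (a ^+ 2) (b ^+ 2) m * (r%:C ^+ 2) ^ m *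
       gauss q alpha x r (2%:Z * m)).
  by apply/funext => m; exact: B_term_pow.
have SE : S = (fun j => u j * series_sum (fun n : int =>
    coef q a b n * (1 * r%:C) ^ n * gauss q alpha x r (j + n))).
  apply/funext => j; have [_] := shift j; rewrite mul1r /S /u /coef.
  rewrite -[- x]mulN1r !exprzMl ?unitfE ?oppr_eq0 ?oner_eq0 //; last first.
    by rewrite -normc_gt0 normc_nneg // ltW.
  move: (B _ _ _ _ _) (series_sum _) (_%:C) (x ^ j) (r%:C ^ j) => Bj Sj W X Y h.
  transitivity (qpoch a q j / qpoch b q j * (-1) ^ j * (W * X * Bj)); first by ring.
  by rewrite h; ring.
split.
- by apply: has_sum_cvg; apply: abs_summable_has_sum; rewrite BpE.
- move=> j; have [aT _] := shift j; rewrite mul1r in aT.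
  exact: has_sum_cvg (abs_summable_has_sum aT).
- by apply: has_sum_cvg; apply: abs_summable_has_sum; rewrite SE.
rewrite SE V4 /B BpE; congr (_ * _).
by rewrite /qpochs_inf !big_cons !big_nil !mulr1 /C !mulrA.
Qed.

(** Here the first two of the three factors, at [r] and [rho r], form the family
indexed by pairs, and the inner series is the third one, at [rho ^ 2 r]. *)
Lemma B_cube_identity :
  num_regular (q ^+ 3) (a ^+ 3) -> den_regular (q ^+ 3) (b ^+ 3) ->
  let S := fun jk : int * int => let: (j, k) := jk in
     qpoch a q j * qpoch a q k * rho ^ k
     * (q `^ (alpha * ((j + k) ^+ 2)%:~R))%:C * x ^ (j + k)
     / (qpoch b q j * qpoch b q k)
     * B q alpha a b (rho ^+ 2 * x * (q `^ (2 * alpha * (j + k)%:~R))%:C) in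
  [/\ series_cvg (B_term (q ^+ 3) (3 * alpha) (a ^+ 3) (b ^+ 3) (x ^+ 3)),
      forall j k : int,
        series_cvg (B_term q alpha a b
          (rho ^+ 2 * x * (q `^ (2 * alpha * (j + k)%:~R))%:C)),
      series_cvg S &
      B (q ^+ 3) (3 * alpha) (a ^+ 3) (b ^+ 3) (x ^+ 3)
      = qpochs_inf [:: b; q%:C / a] q ^+ 3
        / qpochs_inf [:: q%:C; b / a] q ^+ 3
        * (qpochs_inf [:: (q ^+ 3)%:C; b ^+ 3 * a ^- 3] (q ^+ 3)
           / qpochs_inf [:: b ^+ 3; (q ^+ 3)%:C * a ^- 3] (q ^+ 3))
        * series_sum S].
Proof.
move=> ha3 hb3 S; have [r [bar r1 ar]] := radius_exists lt_ba a_neq0 annulus.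
have r0 : 0 < r := le_lt_trans (normc_ge0 _) bar.
have rc0 : r%:C != 0 :> R[i] by rewrite -normc_gt0 normc_nneg // ltW.
have [M HM] := gauss_bounded q_gt0 q_lt1 alpha_ge0 r0 x_neq0 ar.
have rho0 := rho_neq0 R; have rho3 := rho_cube R; have nrho := normc_rho R.
pose ws : seq R[i] := [:: 1; rho; rho ^+ 2].
have prod3 (F : R[i] -> R[i]) : \prod_(w <- ws) F w = F 1 * F rho * F (rho ^+ 2).
  by rewrite !big_cons big_nil mulr1 mulrA.
have wsF (t : R[i]) : \prod_(w <- ws) (1 - w * t) = 1 - t ^+ 3.
  by rewrite prod3 mul1r rho_factorization.
have i1 : rho^-1 = rho ^+ 2 :> R[i].
  by apply: (mulfI rho0); rewrite mulfV // -exprS rho3.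
have i2 : (rho ^+ 2)^-1 = rho :> R[i] by rewrite -i1 invrK.
have wsV (t : R[i]) : \prod_(w <- ws) (1 - w^-1 * t) = 1 - t ^+ 3.
  by rewrite -wsF !prod3 i1 i2 invr1; ring.
have nrho2 : normc (rho ^+ 2 : R[i]) = 1 by rewrite normcX nrho expr1n.
have wsN (w : R[i]) : w \in ws -> normc w = 1.
  by rewrite !inE => /or3P[] /eqP -> //; rewrite normc1.
pose P3 (c : R[i]) := qpoch_inf c (q ^+ 3).
pose D := (P b * P (Q / a)) ^+ 3 * (P3 ((q ^+ 3)%:C) * P3 (b ^+ 3 / a ^+ 3)).
pose N := (P Q * P (b / a)) ^+ 3 * (P3 (b ^+ 3) * P3 ((q ^+ 3)%:C / a ^+ 3)).
have q30 : 0 < q ^+ 3 by rewrite exprn_gt0.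
have q31 : q ^+ 3 < 1 by rewrite exprn_ilt1 // ltW.
have ba1 : normc (b / a) < 1 by exact: lt_trans bar r1.
have D0 : D != 0.
  apply: mulf_neq0; [apply: expf_neq0; apply: mulf_neq0 | apply: mulf_neq0].
  - exact: qpoch_inf_den_neq0.
  - exact: qpoch_inf_num_neq0.
  - by apply: qpoch_inf_neq0_small; rewrite // normc_nneg // ltW.
  - apply: qpoch_inf_neq0_small; rewrite // -expr_div_n normcX exprn_ilt1 ?normc_ge0 //.
have N0 : N != 0.
  apply: mulf_neq0; [by apply: expf_neq0; apply: mulf_neq0 | apply: mulf_neq0].
  - exact: qpoch_inf_den_neq0.
  - by apply: qpoch_inf_num_neq0; rewrite ?expf_neq0.
pose u (t : int * int) :=
  (coef q a b t.1 * (1 * r%:C) ^ t.1) * (coef q a b t.2 * (rho * r%:C) ^ t.2).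
have a1 := coef_circle_summable q_gt0 q_lt1 a_num b_den a_neq0 bar r1 (normc1 R).
have a2 := coef_circle_summable q_gt0 q_lt1 a_num b_den a_neq0 bar r1 nrho.
have [au _] := series_sum_prod a1 a2.
have fact (k : nat) (z : R[i]) : (0 < k)%N -> z ^+ k = 1 ->
    series_sum (fun t => u t * z ^ (t.1 + t.2)) * psi q a b (rho ^+ 2 * (r%:C * z)) =
    N / D * psi (q ^+ 3) (a ^+ 3) (b ^+ 3) ((r%:C * z) ^+ 3).
  move=> k0 zk; have nz := normc_unity_root k0 zk.
  have z0 := unity_root_neq0 k0 zk.
  have nrz : normc (r%:C * z) = r by rewrite normcM nz mulr1 normc_nneg // ltW.
  have circ w : normc w = 1 ->
      abs_summable (fun n : int => coef q a b n * (w * (r%:C * z)) ^ n).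
    by move=> nw; apply: coef_summable; rewrite // normcM nw mul1r nrz.
  have [_ e] := series_sum_prod (circ 1 (normc1 R)) (circ rho nrho).
  have tw (c w : R[i]) (n : int) : w != 0 ->
      c * (w * r%:C) ^ n * z ^ n = c * (w * (r%:C * z)) ^ n.
    by move=> w0; rewrite -mulrA -exprzMl ?unitfE ?mulf_neq0 // mulrA.
  have -> : series_sum (fun t => u t * z ^ (t.1 + t.2)) =
      psi q a b (1 * (r%:C * z)) * psi q a b (rho * (r%:C * z)).
    rewrite /psi -e; congr series_sum; apply/funext => t.
    rewrite -(tw (coef q a b t.1) 1 t.1 (oner_neq0 _)) -(tw (coef q a b t.2) rho t.2 rho0).
    rewrite (expfzDr t.1 t.2 z0); exact: mulrACA.
  have := @psi_roots R q 3 ws q_gt0 q_lt1 isT erefl wsF wsV wsN a b (r%:C * z)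
    a_num b_den a_neq0 ha3 hb3.
  rewrite nrz => /(_ bar r1); rewrite (prod3 (fun w => psi q a b (w * (r%:C * z)))).
  rewrite -/D -/N.
  move: (psi q a b (1 * _)) (psi q a b (rho * _)) (psi q a b (rho ^+ 2 * _))
    (psi (q ^+ 3) _ _ _) => X1 X2 X3 Y h.
  apply: (mulIf D0); rewrite [RHS]mulrAC divfK // -h; ring.
have [V1 V2 V3 V4] := weighted_identity q_gt0 q_lt1 (isT : (0 < 3)%N) a_num b_den a_neq0
  ha3 hb3 bar r1 au nrho2 HM fact.
have shift (j : int) := @B_shift_sum R q alpha r a b (rho ^+ 2) x j q_gt0 r0 x_neq0
  (expf_neq0 2 rho0) (V1 j).
have BpE : B_term (q ^+ 3) (3 * alpha) (a ^+ 3) (b ^+ 3) (x ^+ 3) =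
    (fun m : int => coef (q ^+ 3) (a ^+ 3) (b ^+ 3) m * (r%:C ^+ 3) ^ m *
       gauss q alpha x r (3%:Z * m)).
  by apply/funext => m; exact: B_term_pow.
have SE : S = (fun t => u t * series_sum (fun n : int =>
    coef q a b n * (rho ^+ 2 * r%:C) ^ n * gauss q alpha x r (t.1 + t.2 + n))).
  apply/funext => -[j k]; have [_] := shift (j + k); rewrite /S /u /coef /=.
  rewrite mul1r (exprzMl k) ?unitfE // (expfzDr j k rc0) invfM.
  move: (B _ _ _ _ _) (series_sum _) (_%:C) (x ^ _) (r%:C ^ j) (r%:C ^ k)
    => Bj Sj W X Y Z h.
  transitivity (qpoch a q j / qpoch b q j * (qpoch a q k / qpoch b q k) * rho ^ k *
    (W * X * Bj)); first by ring.
  by rewrite h; ring.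
split.
- by apply: has_sum_cvg; apply: abs_summable_has_sum; rewrite BpE.
- move=> j k; have [aT _] := shift (j + k).
  exact: has_sum_cvg (abs_summable_has_sum aT).
- by apply: has_sum_cvg; apply: abs_summable_has_sum; rewrite SE.
rewrite SE V4 /B BpE mulrA.
rewrite [X in X * _](_ : _ = 1) ?mul1r //.
transitivity (D / N * (N / D)); last by rewrite mulrA divfK // divff.
congr (_ * _); rewrite /qpochs_inf !big_cons !big_nil !mulr1 /D /N /P3.
by rewrite mulf_div.
Qed.

End Identities.

Theorem theorem4p3 (R : realType) (q alpha : R) (a b x : R[i])
    (q_gt0 : 0 < q) (q_lt1 : q < 1) (alpha_ge0 : 0 <= alpha)
    (a_neq0 : a != 0) (x_neq0 : x != 0) (lt_ba : `|b| < `|a|)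
    (annulus : alpha = 0 -> `|b / a| < `|x| /\ `|x| < 1)
    (a_den : forall k : nat, (1 <= k)%N -> a != (q ^+ k)%:C)
    (b_den : forall k : nat, b != (q ^- k)%:C) :
  ((forall k : nat, (1 <= k)%N -> a ^+ 2 != (q ^+ (2 * k))%:C) ->
   (forall k : nat, b ^+ 2 != (q ^- (2 * k))%:C) ->
   let S := fun j : int =>
     qpoch a q j * (q `^ (alpha * (j ^+ 2)%:~R))%:C * (- x) ^ j / qpoch b q j
     * B q alpha a b (x * (q `^ (2 * alpha * j%:~R))%:C) in
   [/\ series_cvg (B_term (q ^+ 2) (2 * alpha) (a ^+ 2) (b ^+ 2) (x ^+ 2)),
       forall j : int,
         series_cvg (B_term q alpha a b (x * (q `^ (2 * alpha * j%:~R))%:C)),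
       series_cvg S &
       qpochs_inf [:: - b; - (q%:C / a); q%:C; b / a] q
       / qpochs_inf [:: - q%:C; - (b / a); b; q%:C / a] q
       * B (q ^+ 2) (2 * alpha) (a ^+ 2) (b ^+ 2) (x ^+ 2)
       = series_sum S])
  /\
  ((forall k : nat, (1 <= k)%N -> a ^+ 3 != (q ^+ (3 * k))%:C) ->
   (forall k : nat, b ^+ 3 != (q ^- (3 * k))%:C) ->
   let S := fun jk : int * int => let: (j, k) := jk in
     qpoch a q j * qpoch a q k * rho ^ k
     * (q `^ (alpha * ((j + k) ^+ 2)%:~R))%:C * x ^ (j + k)
     / (qpoch b q j * qpoch b q k)
     * B q alpha a b (rho ^+ 2 * x * (q `^ (2 * alpha * (j + k)%:~R))%:C) in
   [/\ series_cvg (B_term (q ^+ 3) (3 * alpha) (a ^+ 3) (b ^+ 3) (x ^+ 3)),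
       forall j k : int,
         series_cvg (B_term q alpha a b
           (rho ^+ 2 * x * (q `^ (2 * alpha * (j + k)%:~R))%:C)),
       series_cvg S &
       B (q ^+ 3) (3 * alpha) (a ^+ 3) (b ^+ 3) (x ^+ 3)
       = qpochs_inf [:: b; q%:C / a] q ^+ 3
         / qpochs_inf [:: q%:C; b / a] q ^+ 3
         * (qpochs_inf [:: (q ^+ 3)%:C; b ^+ 3 * a ^- 3] (q ^+ 3)
            / qpochs_inf [:: b ^+ 3; (q ^+ 3)%:C * a ^- 3] (q ^+ 3))
         * series_sum S]).
Proof.
have lt_ba' : normc b < normc a by move: lt_ba; rewrite !normE ltcR.
have ann : alpha = 0 -> normc (b / a) < normc x /\ normc x < 1.
  by move=> /annulus; rewrite !normE -(rmorph1 (real_complex R)) !ltcR.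
split=> [ha hb|ha hb].
  exact: (B_square_identity q_gt0 q_lt1 alpha_ge0 a_neq0 x_neq0 lt_ba' ann a_den b_den
    (num_regular_pow ha) (den_regular_pow hb)).
exact: (B_cube_identity q_gt0 q_lt1 alpha_ge0 a_neq0 x_neq0 lt_ba' ann a_den b_den
  (num_regular_pow ha) (den_regular_pow hb)).
Qed.
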